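(* Let $r\ge 1$ and $n\ge 2$ be integers. The (full) monomial braid group $B(r,1,n)$ is not residually free.
   Context: For integers $r\ge1$ and $n\ge 1$, let \[M(\mathcal{A}_{r,1,n})=\Bigl\{(z_1,\dots,z_n)\in\mathbb{C}^n \;\Big|\; z_1\cdots z_n\prod_{1\le i<j\le n}(z_i^r-z_j^r)\neq 0\Bigr\}\] be the complement of the full monomial arrangement. The full monomial group $G(r,1,n)$ is the group of $n\times n$ matrices having exactly one nonzero entry in each row and column, each nonzero entry being an $r$-th root of unity; it acts freely on $M(\mathcal{A}_{r,1,n})$. The full monomial braid group is the fundamental group of the orbit space, $B(r,1,n)=\pi_1\bigl(M(\mathcal{A}_{r,1,n})/G(r,1,n)\bigr)$. A group $G$ is residually free if for every $x\neq 1$ in $G$ there is a homomorphism $f$ from $G$ to a free group $F$ with $f(x)\neq 1$. *)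

(* Defs.v *)
From HB Require Import structures.
From mathcomp Require Import all_boot all_order all_algebra.
From mathcomp Require Import complex.
From mathcomp Require Import all_classical all_reals all_analysis.
From mathcomp Require Import homotopy lra.
Set Implicit Arguments.
Unset Strict Implicit.
Unset Printing Implicit Defensive.
Import Order.TTheory GRing.Theory Num.Theory.
Import numFieldNormedType.Exports.
Local Open Scope classical_set_scope.
Local Open Scope ring_scope.

Section UnitInterval.
Variable R : realType.

Definition unit_interval : Type := set_type (`[0, 1]%classic : set R).

HB.instance Definition _ := Topological.on unit_interval.

Definition unit_interval_val (t : unit_interval) : R := set_val t.

Lemma clamp_subproof (t : R) :
  Num.max 0 (Num.min t 1) \in (`[0, 1]%classic : set R).
Proof.
apply/mem_set; rewrite /= in_itv /= le_max lexx /= ge_max ler01 /=.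
by rewrite ge_min lexx orbT.
Qed.

(* The retraction of R onto [0, 1]: it lets paths be extended to R, so that
   reparametrizations can be written as arithmetic on R. *)
Definition clamp (t : R) : unit_interval :=
  exist (fun s => s \in (`[0, 1]%classic : set R)) _ (clamp_subproof t).

Lemma unit_interval_bounds (t : unit_interval) :
  0 <= unit_interval_val t <= 1.
Proof.
by case: t => t /= /[dup] /set_mem; rewrite /= in_itv /unit_interval_val.
Qed.

Lemma unit_interval_inj (s t : unit_interval) :
  unit_interval_val s = unit_interval_val t -> s = t.
Proof. exact: val_inj. Qed.

Lemma clampE (t : R) : unit_interval_val (clamp t) = Num.max 0 (Num.min t 1).
Proof. by []. Qed.

Lemma clampK (t : unit_interval) : clamp (unit_interval_val t) = t.
Proof.
apply: unit_interval_inj; rewrite clampE.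
by case/andP: (unit_interval_bounds t) => t0 t1; rewrite min_l // max_r.
Qed.

Lemma clamp_le0 (t : R) : t <= 0 -> clamp t = clamp 0.
Proof.
move=> t0; apply: unit_interval_inj; rewrite !clampE !min_l ?max_l //.
exact: le_trans t0 _.
Qed.

Lemma clamp_ge1 (t : R) : 1 <= t -> clamp t = clamp 1.
Proof. by move=> t0; apply: unit_interval_inj; rewrite !clampE !min_r. Qed.

Lemma val_clamp (t : R) : 0 <= t <= 1 -> unit_interval_val (clamp t) = t.
Proof. by case/andP=> t0 t1; rewrite clampE min_l // max_r. Qed.

Lemma unit_interval_val_continuous : continuous unit_interval_val.
Proof. exact: (@initial_continuous _ _ set_val). Qed.

Lemma clamp_continuous : continuous clamp.
Proof.
apply/continuous_comp_initial => x.
apply: (@continuous_max R R (cst 0) (fun t => Num.min t 1)); first exact: cst_continuous.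
by apply: (@continuous_min R R id (cst 1)); [exact: cvg_id|exact: cst_continuous].
Qed.

Lemma clamp_zero_neq_one : clamp 0 != clamp 1.
Proof.
apply/eqP => /(congr1 unit_interval_val).
by rewrite !val_clamp ?lexx ?ler01 // => /eqP; rewrite eq_sym oner_eq0.
Qed.

HB.instance Definition _ :=
  @isBiPointed.Build unit_interval (clamp 0) (clamp 1) clamp_zero_neq_one.

End UnitInterval.

Section Homotopy.
Variables (R : realType) (X : topologicalType).
Local Notation I := (unit_interval R).
Implicit Types x y z : X.

(* Homotopy of paths relative to the endpoints. *)
Definition path_homotopic x y (p q : {path I from x to y}) : Prop :=
  exists H : I * I -> X,
    [/\ continuous H,
        forall s, H (s, zero) = p s /\ H (s, one) = q s
      & forall t, H (zero, t) = x /\ H (one, t) = y].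

Lemma unit_interval_val0 : unit_interval_val (zero : I) = 0.
Proof. by apply: val_clamp; rewrite lexx ler01. Qed.

Lemma unit_interval_val1 : unit_interval_val (one : I) = 1.
Proof. by apply: val_clamp; rewrite lexx ler01. Qed.

Lemma comp_continuous (T U V : topologicalType) (f : T -> U) (g : U -> V) :
  continuous f -> continuous g -> continuous (fun t => g (f t)).
Proof. by move=> cf cg t; apply: continuous_comp; [exact: cf|exact: cg]. Qed.

Lemma pair_continuous (T U V : topologicalType) (f : T -> U) (g : T -> V) :
  continuous f -> continuous g -> continuous (fun t => (f t, g t)).
Proof. by move=> cf cg t; apply: cvg_pair; [exact: cf|exact: cg]. Qed.

Lemma fst_continuous (T U : topologicalType) : continuous (@fst T U).
Proof. by move=> t; exact: cvg_fst. Qed.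

Lemma snd_continuous (T U : topologicalType) : continuous (@snd T U).
Proof. by move=> t; exact: cvg_snd. Qed.

Lemma unit_interval_fst_continuous :
  continuous (fun st : I * I => unit_interval_val st.1).
Proof.
exact: (comp_continuous (@fst_continuous _ _)
  (@unit_interval_val_continuous R)).
Qed.

Lemma unit_interval_snd_continuous :
  continuous (fun st : I * I => unit_interval_val st.2).
Proof.
exact: (comp_continuous (@snd_continuous _ _)
  (@unit_interval_val_continuous R)).
Qed.

(* The pasting lemma along a level set. *)
Lemma continuous_if_le (T Y : topologicalType) (c : T -> R) (a : R)
    (f g : T -> Y) :
  continuous c -> continuous f -> continuous g ->
  (forall t, c t = a -> f t = g t) ->
  continuous (fun t => if c t <= a then f t else g t).
Proof.
move=> cc cf cg fg t; case: (ltgtP (c t) a) => cta.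
- rewrite /continuous_at (ltW cta) => U /cf fU.
  apply: (filterS _ (filterI (cvgr_lt _ (cc t) _ cta) fU)).
  by move=> s [/= /ltW ->].
- rewrite /continuous_at leNgt cta /= => U /cg gU.
  apply: (filterS _ (filterI (cvgr_gt _ (cc t) _ cta) gU)).
  by move=> s [/= cs]; rewrite leNgt cs.
- rewrite /continuous_at cta lexx => U fU.
  have gU : nbhs (g t) U by rewrite -fg.
  have nf : nbhs t (f @^-1` U) := cf t _ fU.
  have ng : nbhs t (g @^-1` U) := cg t _ gU.
  apply: (filterS _ (filterI nf ng)).
  by move=> s [/= fs gs]; case: ifP.
Qed.

Definition extend_path x y (p : {path I from x to y}) (t : R) : X :=
  p (clamp t).

Lemma extend_path_continuous x y (p : {path I from x to y}) :
  continuous (extend_path p).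
Proof.
by apply: comp_continuous; [exact: clamp_continuous|exact: cts_fun].
Qed.

Lemma extend_path_le0 x y (p : {path I from x to y}) t :
  t <= 0 -> extend_path p t = x.
Proof. by move=> t0; rewrite /extend_path clamp_le0 //; exact: path_zero. Qed.

Lemma extend_path_ge1 x y (p : {path I from x to y}) t :
  1 <= t -> extend_path p t = y.
Proof. by move=> t0; rewrite /extend_path clamp_ge1 //; exact: path_one. Qed.

Lemma extend_path_val x y (p : {path I from x to y}) t :
  extend_path p (unit_interval_val t) = p t.
Proof. by rewrite /extend_path clampK. Qed.

Lemma affine_continuous (T : topologicalType) (c : T -> R) (a b : R) :
  continuous c -> continuous (fun t => a * c t + b).
Proof.
move=> cc t; apply: cvgD; last exact: cvg_cst.
by apply: cvgM; [exact: cvg_cst|exact: cc].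
Qed.

(* Two reparametrizations of the same path are homotopic by a straight line. *)
Lemma reparametrization_homotopic x y z w (p : {path I from x to y})
    (q r : {path I from z to w}) (u v : R -> R) :
  continuous u -> continuous v ->
  (forall s : I, q s = extend_path p (u (unit_interval_val s))) ->
  (forall s : I, r s = extend_path p (v (unit_interval_val s))) ->
  (forall t, 0 <= t <= 1 -> extend_path p ((1 - t) * u 0 + t * v 0) = z) ->
  (forall t, 0 <= t <= 1 -> extend_path p ((1 - t) * u 1 + t * v 1) = w) ->
  path_homotopic q r.
Proof.
move=> cu cv qE rE p0 p1.
exists (fun st => let t := unit_interval_val st.2 in
  let s := unit_interval_val st.1 in
  extend_path p ((1 - t) * u s + t * v s)); split.
- apply: comp_continuous (@extend_path_continuous _ _ p) => st.
  have c1 := @unit_interval_fst_continuous.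
  have c2 := @unit_interval_snd_continuous.
  apply: cvgD; apply: cvgM.
  + by apply: cvgB; [exact: cvg_cst|exact: c2].
  + exact: (comp_continuous c1 cu).
  + exact: c2.
  + exact: (comp_continuous c1 cv).
- move=> s /=; rewrite unit_interval_val0 unit_interval_val1 qE rE.
  by split; congr (extend_path p _); rewrite ?subr0 ?subrr !(mul1r, mul0r) ?addr0 ?add0r.
- move=> t /=; rewrite unit_interval_val0 unit_interval_val1.
  by split; [apply: p0|apply: p1]; exact: unit_interval_bounds.
Qed.

Lemma path_homotopic_refl x y (p : {path I from x to y}) : path_homotopic p p.
Proof.
exists (fun st => p st.1); split => //.
- by apply: comp_continuous; [exact: fst_continuous|exact: cts_fun].
- by move=> t; rewrite path_zero path_one.
Qed.

Lemma path_homotopic_sym x y (p q : {path I from x to y}) :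
  path_homotopic p q -> path_homotopic q p.
Proof.
case=> H [cH H0 H1].
pose f (st : I * I) := (st.1, clamp (- 1 * unit_interval_val st.2 + 1)) : I * I.
have cf : continuous f.
  apply: pair_continuous; first exact: fst_continuous.
  apply: comp_continuous (@clamp_continuous R).
  exact: affine_continuous unit_interval_snd_continuous.
exists (H \o f); split.
- exact: comp_continuous cf cH.
- move=> s; rewrite /f /= unit_interval_val0 unit_interval_val1.
  rewrite mulr0 add0r mulr1 addNr.
  by have [? ?] := H0 s; split.
- by move=> t; exact: H1.
Qed.

Lemma path_homotopic_trans x y (p q r : {path I from x to y}) :
  path_homotopic p q -> path_homotopic q r -> path_homotopic p r.
Proof.
case=> H [cH H0 H1] [K [cK K0 K1]].
have c2 := unit_interval_snd_continuous.
have cl (a b : R) (L : I * I -> X) : continuous L ->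
    continuous (fun st : I * I => L (st.1, clamp (a * unit_interval_val st.2 + b))).
  move=> cL; apply: comp_continuous cL.
  apply: pair_continuous; first exact: fst_continuous.
  by apply: comp_continuous (@clamp_continuous R); exact: affine_continuous.
exists (fun st => if unit_interval_val st.2 <= 2^-1
  then H (st.1, clamp (2 * unit_interval_val st.2 + 0))
  else K (st.1, clamp (2 * unit_interval_val st.2 + (- 1)))); split.
- apply: continuous_if_le; [exact: c2|exact: cl|exact: cl|].
  move=> st ->; rewrite divff ?pnatr_eq0 // subrr addr0.
  by rewrite (H0 _).2 (K0 _).1.
- move=> s /=; rewrite unit_interval_val0 unit_interval_val1.
  rewrite invr_ge0 ler0n !mulr0 addr0 (_ : (1 <= 2^-1 :> R) = false); last by lra.
  by rewrite (H0 _).1 mulr1 (_ : 2 + -1 = 1 :> R) ?(K0 _).2 //; lra.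
- by move=> t /=; case: ifP => _; rewrite ?(H1 _).1 ?(H1 _).2 ?(K1 _).1 ?(K1 _).2.
Qed.

Section Concatenation.
Variables x y z : X.
Variables (p : {path I from x to y}) (q : {path I from y to z}).

Definition concat_fun (t : R) : X :=
  if t <= 2^-1 then extend_path p (2 * t + 0)
  else extend_path q (2 * t + (- 1)).

Lemma concat_fun_continuous : continuous concat_fun.
Proof.
have cl (a b : R) : continuous (fun t : R => a * t + b).
  by apply: affine_continuous => t; exact: cvg_id.
apply: continuous_if_le.
- by move=> t; exact: cvg_id.
- exact: comp_continuous (cl _ _) (@extend_path_continuous _ _ _).
- exact: comp_continuous (cl _ _) (@extend_path_continuous _ _ _).
- move=> t ->; rewrite divff ?pnatr_eq0 // subrr addr0.
  by rewrite extend_path_ge1 // extend_path_le0.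
Qed.

Definition concat_path_fun (t : I) : X := concat_fun (unit_interval_val t).

Lemma concat_path_continuous : continuous concat_path_fun.
Proof.
exact: comp_continuous (@unit_interval_val_continuous R)
  concat_fun_continuous.
Qed.

Lemma concat_path_zero : concat_path_fun zero = x.
Proof.
rewrite /concat_path_fun /concat_fun unit_interval_val0 invr_ge0 ler0n.
by rewrite extend_path_le0 // mulr0 addr0.
Qed.

Lemma concat_path_one : concat_path_fun one = z.
Proof.
rewrite /concat_path_fun /concat_fun unit_interval_val1.
rewrite (_ : (1 <= 2^-1 :> R) = false); last by lra.
by rewrite extend_path_ge1 //; lra.
Qed.

Definition concat_path : {path I from x to z} :=
  mk_path concat_path_continuous concat_path_zero concat_path_one.

Lemma concat_pathE t : concat_path t = concat_fun (unit_interval_val t).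
Proof. by []. Qed.

End Concatenation.

Section Reversal.
Variables (x y : X) (p : {path I from x to y}).

Definition reverse_path_fun (t : I) : X :=
  extend_path p (- 1 * unit_interval_val t + 1).

Lemma reverse_path_continuous : continuous reverse_path_fun.
Proof.
apply: comp_continuous (@extend_path_continuous _ _ p).
exact: affine_continuous (@unit_interval_val_continuous R).
Qed.

Lemma reverse_path_zero : reverse_path_fun zero = y.
Proof.
by rewrite /reverse_path_fun unit_interval_val0 mulr0 add0r extend_path_ge1.
Qed.

Lemma reverse_path_one : reverse_path_fun one = x.
Proof.
by rewrite /reverse_path_fun unit_interval_val1 mulr1 addNr extend_path_le0.
Qed.

Definition reverse_path : {path I from y to x} :=
  mk_path reverse_path_continuous reverse_path_zero reverse_path_one.

Lemma reverse_pathE t :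
  reverse_path t = extend_path p (- 1 * unit_interval_val t + 1).
Proof. by []. Qed.

End Reversal.

Definition constant_path x : {path I from x to x} := cst x.

Lemma extend_reverse_path x y (p : {path I from x to y}) t : 0 <= t <= 1 ->
  extend_path (reverse_path p) t = extend_path p (- 1 * t + 1).
Proof. by move=> t01; rewrite {1}/extend_path reverse_pathE val_clamp. Qed.

Lemma extend_concat_path x y z (p : {path I from x to y})
    (q : {path I from y to z}) t : 0 <= t <= 1 ->
  extend_path (concat_path p q) t = concat_fun p q t.
Proof. by move=> t01; rewrite {1}/extend_path concat_pathE val_clamp. Qed.

Lemma concat_path_homotopic x y z (p p' : {path I from x to y})
    (q q' : {path I from y to z}) :
  path_homotopic p p' -> path_homotopic q q' ->
  path_homotopic (concat_path p q) (concat_path p' q').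
Proof.
case=> H [cH H0 H1] [K [cK K0 K1]].
have c1 := unit_interval_fst_continuous.
have cl (a b : R) (L : I * I -> X) : continuous L ->
    continuous (fun st : I * I => L (clamp (a * unit_interval_val st.1 + b), st.2)).
  move=> cL; apply: comp_continuous cL.
  apply: pair_continuous; last exact: snd_continuous.
  by apply: comp_continuous (@clamp_continuous R); exact: affine_continuous.
exists (fun st => if unit_interval_val st.1 <= 2^-1
  then H (clamp (2 * unit_interval_val st.1 + 0), st.2)
  else K (clamp (2 * unit_interval_val st.1 + (- 1)), st.2)); split.
- apply: continuous_if_le; [exact: c1|exact: cl|exact: cl|].
  move=> st ->; rewrite divff ?pnatr_eq0 // subrr addr0.
  by rewrite (H1 _).2 (K1 _).1.
- move=> s /=; rewrite !concat_pathE /concat_fun /extend_path.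
  by case: ifP => _; rewrite ?(H0 _).1 ?(H0 _).2 ?(K0 _).1 ?(K0 _).2.
- move=> t /=; rewrite unit_interval_val0 unit_interval_val1.
  rewrite invr_ge0 ler0n !mulr0 addr0 (_ : (1 <= 2^-1 :> R) = false); last by lra.
  by rewrite (H1 _).1 mulr1 (_ : 2 + -1 = 1 :> R) ?(K1 _).2 //; lra.
Qed.

Lemma reverse_path_homotopic x y (p q : {path I from x to y}) :
  path_homotopic p q -> path_homotopic (reverse_path p) (reverse_path q).
Proof.
case=> H [cH H0 H1].
pose f (st : I * I) := (clamp (- 1 * unit_interval_val st.1 + 1), st.2) : I * I.
have cf : continuous f.
  apply: pair_continuous; last exact: snd_continuous.
  apply: comp_continuous (@clamp_continuous R).
  exact: affine_continuous unit_interval_fst_continuous.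
exists (H \o f); split.
- exact: comp_continuous cf cH.
- by move=> s; rewrite /f /= !reverse_pathE /extend_path; exact: H0.
- move=> t; rewrite /f /= unit_interval_val0 unit_interval_val1.
  rewrite mulr0 add0r mulr1 addNr.
  by have [? ?] := H1 t; split.
Qed.

Lemma concat_pathA x y z w (p : {path I from x to y})
    (q : {path I from y to z}) (r : {path I from z to w}) :
  path_homotopic (concat_path p (concat_path q r))
                 (concat_path (concat_path p q) r).
Proof.
have cl (a b : R) : continuous (fun t : R => a * t + b).
  by apply: affine_continuous => t; exact: cvg_id.
pose v (t : R) := if t <= 4^-1 then 2 * t + 0
  else if t <= 2^-1 then 1 * t + 4^-1 else 2^-1 * t + 2^-1.
have cv : continuous v.
  apply: continuous_if_le; [by move=> t; exact: cvg_id|exact: cl| |].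
    apply: continuous_if_le; [by move=> t; exact: cvg_id|exact: cl|exact: cl|].
    by move=> t ->; lra.
  by move=> t ->; case: ifP => ?; lra.
apply: (@reparametrization_homotopic _ _ _ _ (concat_path p (concat_path q r))
  _ _ id v) => //.
- by move=> t; exact: cvg_id.
- by move=> s; rewrite extend_path_val.
- move=> s; rewrite concat_pathE; have := unit_interval_bounds s.
  move: (unit_interval_val s) => t /andP[t0 t1].
  have vt : 0 <= v t <= 1 by rewrite /v; case: ifP => ?; [lra|]; case: ifP => ?; lra.
  rewrite (extend_concat_path _ _ vt) /concat_fun /v.
  case: (leP t 4^-1) => ta.
    rewrite ifT; last by lra.
    rewrite ifT; last by lra.
    have tt : 0 <= 2 * t + 0 <= 1 by lra.
    rewrite (extend_concat_path _ _ tt) /concat_fun ifT //; lra.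
  case: (leP t 2^-1) => tb.
    rewrite ifF; last by apply/negbTE; rewrite -ltNge; lra.
    have tt : 0 <= 2 * t + 0 <= 1 by lra.
    have tt' : 0 <= 2 * (1 * t + 4^-1) + (- 1) <= 1 by lra.
    rewrite (extend_concat_path _ _ tt).
    rewrite (extend_concat_path _ _ tt') /concat_fun.
    rewrite ifF; last by apply/negbTE; rewrite -ltNge; lra.
    rewrite ifT; last by lra.
    by congr (extend_path q _); lra.
  rewrite ifF; last by apply/negbTE; rewrite -ltNge; lra.
  have tt' : 0 <= 2 * (2^-1 * t + 2^-1) + (- 1) <= 1 by lra.
  rewrite (extend_concat_path _ _ tt') /concat_fun.
  rewrite ifF; last by apply/negbTE; rewrite -ltNge; lra.
  by congr (extend_path r _); lra.
- move=> t t01; rewrite extend_path_le0 // /v ifT; last by lra.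
  by lra.
- move=> t t01; rewrite extend_path_ge1 // /v ifF; last by apply/negbTE; rewrite -ltNge; lra.
  by rewrite ifF; [lra|apply/negbTE; rewrite -ltNge; lra].
Qed.

Lemma concat_1path x y (p : {path I from x to y}) :
  path_homotopic (concat_path (constant_path x) p) p.
Proof.
have cl (a b : R) : continuous (fun t : R => a * t + b).
  by apply: affine_continuous => t; exact: cvg_id.
apply: (@reparametrization_homotopic _ _ _ _ p _ _ (fun t => 2 * t + (- 1)) id).
- exact: cl.
- by move=> t; exact: cvg_id.
- move=> s; rewrite concat_pathE /concat_fun; case: leP => // ?.
  by rewrite [RHS]extend_path_le0 //; lra.
- by move=> s; rewrite extend_path_val.
- by move=> t t01; rewrite extend_path_le0 //; lra.
- by move=> t t01; rewrite extend_path_ge1 //; lra.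
Qed.

Lemma concat_path1 x y (p : {path I from x to y}) :
  path_homotopic (concat_path p (constant_path y)) p.
Proof.
have cl (a b : R) : continuous (fun t : R => a * t + b).
  by apply: affine_continuous => t; exact: cvg_id.
apply: (@reparametrization_homotopic _ _ _ _ p _ _ (fun t => 2 * t + 0) id).
- exact: cl.
- by move=> t; exact: cvg_id.
- move=> s; rewrite concat_pathE /concat_fun; case: leP => // ?.
  by rewrite [RHS]extend_path_ge1 //; lra.
- by move=> s; rewrite extend_path_val.
- by move=> t t01; rewrite extend_path_le0 //; lra.
- by move=> t t01; rewrite extend_path_ge1 //; lra.
Qed.

Lemma concat_pathV x y (p : {path I from x to y}) :
  path_homotopic (concat_path p (reverse_path p)) (constant_path x).
Proof.
have cl (a b : R) : continuous (fun t : R => a * t + b).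
  by apply: affine_continuous => t; exact: cvg_id.
apply: (@reparametrization_homotopic _ _ _ _ p _ _
  (fun t => if t <= 2^-1 then 2 * t + 0 else - 2 * t + 2) (cst 0)).
- apply: continuous_if_le; [by move=> t; exact: cvg_id|exact: cl|exact: cl|].
  by move=> t ->; lra.
- exact: cst_continuous.
- move=> s; rewrite concat_pathE /concat_fun; case: leP => // ?.
  have := unit_interval_bounds s => /andP[? ?].
  have tt : 0 <= 2 * unit_interval_val s + (- 1) <= 1 by lra.
  rewrite extend_reverse_path //.
  by congr (extend_path p _); lra.
- by move=> s; rewrite extend_path_le0.
- move=> t t01; rewrite extend_path_le0 // ifT; last by lra.
  by rewrite /cst; lra.
- move=> t t01; rewrite extend_path_le0 // ifF; last by apply/negbTE; rewrite -ltNge; lra.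
  by rewrite /cst; lra.
Qed.

Lemma reverse_pathK x y (p : {path I from x to y}) :
  reverse_path (reverse_path p) = p.
Proof.
apply/path_eqP => s; rewrite reverse_pathE.
have := unit_interval_bounds s => /andP[? ?].
have tt : 0 <= - 1 * unit_interval_val s + 1 <= 1 by lra.
rewrite extend_reverse_path //.
by rewrite -[RHS]extend_path_val; congr (extend_path p _); lra.
Qed.

Lemma concat_Vpath x y (p : {path I from x to y}) :
  path_homotopic (concat_path (reverse_path p) p) (constant_path y).
Proof. by have := concat_pathV (reverse_path p); rewrite reverse_pathK. Qed.

End Homotopy.

Section FundamentalGroup.
Variables (R : realType) (X : topologicalType) (x : X).
Local Notation I := (unit_interval R).
Local Open Scope quotient_scope.

Definition loop : Type := {path I from x to x}.
HB.instance Definition _ := Choice.on loop.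

Definition loop_homotopic (p q : loop) : bool := `[< path_homotopic p q >].

Lemma loop_homotopic_refl : reflexive loop_homotopic.
Proof. by move=> p; apply/asboolP; exact: path_homotopic_refl. Qed.

Lemma loop_homotopic_sym : symmetric loop_homotopic.
Proof.
by move=> p q; apply/asboolP/asboolP; exact: path_homotopic_sym.
Qed.

Lemma loop_homotopic_trans : transitive loop_homotopic.
Proof.
move=> q p r /asboolP pq /asboolP qr; apply/asboolP.
exact: path_homotopic_trans pq qr.
Qed.

Canonical loop_homotopic_equiv := EquivRel loop_homotopic
  loop_homotopic_refl loop_homotopic_sym loop_homotopic_trans.

(* The fundamental group of X based at x; a product of classes of loops runs
   through the left factor first. *)
Definition fundamental_group : Type := {eq_quot loop_homotopic_equiv}.
HB.instance Definition _ := Choice.on fundamental_group.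

Definition loop_class (p : loop) : fundamental_group :=
  \pi_({eq_quot loop_homotopic_equiv}) p.

Definition loop_repr (a : fundamental_group) : loop :=
  repr (a : {eq_quot loop_homotopic_equiv}).

Lemma loop_reprK a : loop_class (loop_repr a) = a.
Proof. exact: reprK. Qed.

Lemma loop_classP (p q : loop) :
  loop_class p = loop_class q <-> path_homotopic p q.
Proof.
by split => [/eqmodP/asboolP //|pq]; apply/eqmodP/asboolP.
Qed.

Definition pi1_one : fundamental_group := loop_class (constant_path R x).

Definition pi1_mul (a b : fundamental_group) : fundamental_group :=
  loop_class (concat_path (loop_repr a) (loop_repr b)).

Definition pi1_inv (a : fundamental_group) : fundamental_group :=
  loop_class (reverse_path (loop_repr a)).

Lemma pi1_mulE (p q : loop) :
  pi1_mul (loop_class p) (loop_class q) = loop_class (concat_path p q).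
Proof.
by apply/loop_classP/concat_path_homotopic; apply/loop_classP; exact: loop_reprK.
Qed.

Lemma pi1_invE (p : loop) :
  pi1_inv (loop_class p) = loop_class (reverse_path p).
Proof.
by apply/loop_classP/reverse_path_homotopic/loop_classP; exact: loop_reprK.
Qed.

Lemma pi1_mulA : associative pi1_mul.
Proof.
move=> a b c; rewrite -(loop_reprK a) -(loop_reprK b) -(loop_reprK c).
by rewrite !pi1_mulE; apply/loop_classP; exact: concat_pathA.
Qed.

Lemma pi1_mul1 : left_id pi1_one pi1_mul.
Proof.
move=> a; rewrite -(loop_reprK a) pi1_mulE.
by apply/loop_classP; exact: concat_1path.
Qed.

Lemma pi1_mulr1 : right_id pi1_one pi1_mul.
Proof.
move=> a; rewrite -(loop_reprK a) pi1_mulE.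
by apply/loop_classP; exact: concat_path1.
Qed.

Lemma pi1_mulV : left_inverse pi1_one pi1_inv pi1_mul.
Proof.
move=> a; rewrite -(loop_reprK a) pi1_invE pi1_mulE.
by apply/loop_classP; exact: concat_Vpath.
Qed.

Lemma pi1_mulrV : right_inverse pi1_one pi1_inv pi1_mul.
Proof.
move=> a; rewrite -(loop_reprK a) pi1_invE pi1_mulE.
by apply/loop_classP; exact: concat_pathV.
Qed.

HB.instance Definition _ := isGroup.Build fundamental_group
  pi1_mulA pi1_mul1 pi1_mulr1 pi1_mulV pi1_mulrV.

End FundamentalGroup.

Section FullMonomialArrangement.
Variables (R : realType) (r n : nat).
Local Open Scope quotient_scope.

(* The complex numbers, as a field whose topology is that of its norm. *)
Definition complexes : numClosedFieldType := R[i]%C.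

Definition monomial_complement : set 'cV[complexes]_n :=
  [set z | (\prod_(i < n) z i ord0) *
           \prod_(i < n) \prod_(j < n | (i < j)%N)
             (z i ord0 ^+ r - z j ord0 ^+ r) != 0].

(* G(r,1,n), acting on column vectors by multiplication on the left. *)
Definition full_monomial_group : set 'M[complexes]_n :=
  [set g | [/\ forall i, exists! j, g i j != 0,
               forall j, exists! i, g i j != 0
             & forall i j, g i j != 0 -> g i j ^+ r = 1]].

Lemma full_monomial_group1 : full_monomial_group 1%:M.
Proof.
have E (i j : 'I_n) : (1%:M : 'M[complexes]_n) i j != 0 -> i = j.
  by rewrite mxE; case: (i =P j) => // _; rewrite mulr0n eqxx.
have D (i : 'I_n) : (1%:M : 'M[complexes]_n) i i != 0.
  by rewrite mxE eqxx oner_neq0.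
split=> [i|j|i j].
- by exists i; split => // j /E.
- by exists j; split => // i /E.
- by move/[dup]/E ->; rewrite mxE eqxx expr1n.
Qed.

Lemma full_monomial_groupM g h : full_monomial_group g ->
  full_monomial_group h -> full_monomial_group (g *m h).
Proof.
move=> [g1 g2 g3] [h1 h2 h3].
have E i j k : g i j != 0 -> (g *m h) i k = g i j * h j k.
  move=> gij; rewrite mxE (bigD1 j) //= big1 ?addr0 // => l lj.
  have [j' [_ uj]] := g1 i; have [->|/uj e] := eqVneq (g i l) 0.
    by rewrite mul0r.
  by rewrite -e (uj _ gij) eqxx in lj.
split=> [i|k|i k].
- have [j [gij _]] := g1 i; have [k [hjk uk]] := h1 j.
  exists k; split=> [|k']; first by rewrite (E _ _ _ gij) mulf_neq0.
  by rewrite (E _ _ _ gij) mulf_eq0 negb_or => /andP[_ /uk].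
- have [j [hjk uj]] := h2 k; have [i [gij ui]] := g2 j.
  exists i; split=> [|i']; first by rewrite (E _ _ _ gij) mulf_neq0.
  have [j' [gij' _]] := g1 i'.
  rewrite (E _ _ _ gij') mulf_eq0 negb_or => /andP[_ /uj e].
  by apply: ui; rewrite e.
- have [j [gij _]] := g1 i.
  rewrite (E _ _ _ gij) mulf_eq0 negb_or => /andP[_ hjk].
  by rewrite exprMn (g3 _ _ gij) (h3 _ _ hjk) mulr1.
Qed.

Lemma full_monomial_groupV g : full_monomial_group g ->
  exists2 h, full_monomial_group h & h *m g = 1%:M.
Proof.
move=> [g1 g2 g3]; exists (\matrix_(i, j) (g j i)^-1).
  split=> [i|j|i j].
  - have [j [gji uj]] := g2 i; exists j; split=> [|j'].
      by rewrite mxE invr_eq0.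
    by rewrite mxE invr_eq0 => /uj.
  - have [i [gji ui]] := g1 j; exists i; split=> [|i'].
      by rewrite mxE invr_eq0.
    by rewrite mxE invr_eq0 => /ui.
  - by rewrite mxE invr_eq0 exprVn => /g3 ->; rewrite invr1.
apply/matrixP => i k; rewrite !mxE; have [j [gji uj]] := g2 i.
rewrite (bigD1 j) //= big1 => [|l lj]; last first.
  have [e|/uj e] := eqVneq (g l i) 0; first by rewrite mxE e invr0 mul0r.
  by rewrite e eqxx in lj.
rewrite mxE addr0; have [<-|ik] := eqVneq i k; first by rewrite mulVf.
have [e|gjk] := eqVneq (g j k) 0; first by rewrite e mulr0.
have [k' [_ u]] := g1 j.
by rewrite -(u _ gji) -(u _ gjk) eqxx in ik.
Qed.

Definition same_orbit (z w : monomial_complement) : bool :=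
  `[< exists2 g, full_monomial_group g & set_val w = g *m set_val z >].

Lemma same_orbit_refl : reflexive same_orbit.
Proof.
move=> z; apply/asboolP; exists 1%:M; first exact: full_monomial_group1.
by rewrite mul1mx.
Qed.

Lemma same_orbit_sym : symmetric same_orbit.
Proof.
suff S z w : same_orbit z w -> same_orbit w z.
  by move=> z w; apply/idP/idP; exact: S.
move=> /asboolP[g /full_monomial_groupV[h Gh hg] wE].
by apply/asboolP; exists h => //; rewrite wE mulmxA hg mul1mx.
Qed.

Lemma same_orbit_trans : transitive same_orbit.
Proof.
move=> w z v /asboolP[g Gg wE] /asboolP[h Gh vE]; apply/asboolP.
by exists (h *m g); [exact: full_monomial_groupM|rewrite vE wE mulmxA].
Qed.

Canonical same_orbit_equiv := EquivRel same_orbit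
  same_orbit_refl same_orbit_sym same_orbit_trans.

Definition monomial_orbit_space : topologicalType :=
  quotient_topology {eq_quot same_orbit_equiv}.

(* The complement is nonempty and path connected, so b does not matter up to
   isomorphism. *)
Definition monomial_braid_group (b : monomial_orbit_space) : groupType :=
  fundamental_group R b.

End FullMonomialArrangement.

Section ResiduallyFree.
Local Open Scope group_scope.

(* F is free with basis S, by the universal property. A map {multiplicative
   F -> H} between groups preserves 1 and inverses. *)
Definition free_on (F : groupType) (S : set F) : Prop :=
  forall (H : groupType) (f : F -> H),
    (exists g : {multiplicative F -> H}, forall s, S s -> g s = f s) /\
    (forall g1 g2 : {multiplicative F -> H},
       (forall s, S s -> g1 s = g2 s) -> g1 =1 g2).

Definition free_group (F : groupType) : Prop :=
  exists S : set F, free_on S.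

Definition residually_free (G : groupType) : Prop :=
  forall x : G, x != 1 ->
    exists (F : groupType) (f : {multiplicative G -> F}),
      free_group F /\ f x != 1.

End ResiduallyFree.

(* Main.v *)
From HB Require Import structures.
Require Import Defs.
From mathcomp Require Import all_boot all_order all_algebra.
From mathcomp Require Import perm complex.
From mathcomp Require Import all_classical all_reals all_analysis.
From mathcomp Require Import homotopy zify lra ring.
Set Implicit Arguments.
Unset Strict Implicit.
Unset Printing Implicit Defensive.
Import Order.TTheory GRing.Theory Num.Theory.
Import numFieldNormedType.Exports.
Local Open Scope classical_set_scope.
Local Open Scope ring_scope.

(** Turn the regular configuration [z_j = exp(i pi j / (r n))] by the angle
    [pi / (r n)] and square the coordinates: the powers [z_j ^ (2r)] are the
    [n]-th roots of unity, the turn permutes them, and so the path closes up in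
    the orbit space, to a loop [x]. Its power [x ^ n] comes from the turn by
    [pi / r], which closes up at every configuration. Turning a whole path of
    configurations in this way fills a square ([full_turn_commute]), hence
    [x ^ n] commutes with the class [y] of any loop that lifts to a path
    starting at the regular configuration.

    In a free group roots are unique. If [x ^ n] commutes with [y] there, the
    conjugate of [x] by [y] has the same [n]-th power as [x], so [x] and [y]
    commute; the same implication then holds in residually free groups
    ([residually_free_commute_root]). Uniqueness of roots is inherited from
    unitriangular rational matrices ([unitriangular_roots]), since the elements
    of a free group are separated by unitriangular representations
    ([free_on_unitriangular]).

    It remains to find [y] that does not commute with [x]. The map that squares
    coordinates makes the complement with [2r] in place of [r] a covering of the
    orbit space ([cover_covering]), on which homotopic loops have lifts with
    the same end ([monodromy]). For [y] take the image of a path which changes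
    the sign of [z_0]. One product of [x] and [y] lifts to a path whose end has
    first coordinate [z_1], the other to a path whose end has first coordinate
    [- z_1] ([step_flip_not_commute]).

    Base points are exchanged through paths: the complement is path connected
    because a complex line meets the arrangement in finitely many points
    ([configuration_path_connected]). *)

(** * Generation of free groups and of groups of units *)

Section FreeGroupGeneration.
Local Open Scope group_scope.

Lemma multiplicative_one (G H : groupType) (f : {multiplicative G -> H}) :
  f 1 = 1.
Proof. by apply: (@mulgI _ (f 1)); rewrite -gmulfM !mulg1. Qed.

Lemma multiplicative_inv (G H : groupType) (f : {multiplicative G -> H}) x :
  f x^-1 = (f x)^-1.
Proof.
by apply: (@mulgI _ (f x)); rewrite -gmulfM !mulgV multiplicative_one.
Qed.

Lemma multiplicative_exp (G H : groupType) (f : {multiplicative G -> H}) x n :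
  f (x ^+ n) = f x ^+ n.
Proof.
by elim: n => [|n IH]; rewrite ?multiplicative_one // !expgS gmulfM IH.
Qed.

(** The retraction onto the subgroup cut out by [P], given by freeness, agrees
    with the identity on [S]; uniqueness makes it the identity. *)
Lemma free_on_generated (F : groupType) (S P : set F) :
  free_on S -> P 1 -> (forall x y, P x -> P y -> P (x / y)) -> S `<=` P ->
  forall x, P x.
Proof.
move=> freeS P1 PF SP x.
pose p : pred F := fun y => `[< P y >].
have pc : group_closed p.
  split=> [|y z]; rewrite !unfold_in; first exact/asboolP.
  by move=> /asboolP Py /asboolP Pz; apply/asboolP; exact: PF.
pose K : groupType := HB.pack {y : F | p y}
  (SubChoice_isSubGroup.Build F p {y : F | p y} pc).
pose j (y : F) : K := insubd (1 : K) y.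
have [[g gj] _] := freeS K j.
have iM : {morph (fun y : F => y) : y z / y * z} by [].
have gM : {morph (fun y => val (g y) : F) : y z / y * z}.
  by move=> y z; rewrite gmulfM.
pose h : {multiplicative F -> F} :=
  HB.pack (fun y => val (g y) : F) (isMultiplicative.Build F F _ gM).
pose i : {multiplicative F -> F} :=
  HB.pack (fun y : F => y) (isMultiplicative.Build F F _ iM).
have /(_ h i) hi := (freeS F id).2.
have hE : h =1 i; last by rewrite -[x]/(i x) -hE; apply/asboolP; exact: (valP (g x)).
apply: hi => s Ss; rewrite /h /= gj // insubdK //.
by rewrite unfold_in; apply/asboolP; exact: SP.
Qed.

End FreeGroupGeneration.

Section RingUnits.
Variable A : unitRingType.

Definition ring_units : Type := {x : A | x \is a GRing.unit}.
HB.instance Definition _ := Choice.on ring_units.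

Definition units_one : ring_units := exist (fun x => x \is a GRing.unit) 1 (unitr1 A).

Lemma units_mul_subproof (x y : ring_units) :
  val x * val y \is a GRing.unit.
Proof. by rewrite unitrMl ?(valP x) // (valP y). Qed.

Definition units_mul (x y : ring_units) : ring_units :=
  exist (fun x => x \is a GRing.unit) _ (units_mul_subproof x y).

Lemma units_inv_subproof (x : ring_units) : (val x)^-1 \is a GRing.unit.
Proof. by rewrite unitrV (valP x). Qed.

Definition units_inv (x : ring_units) : ring_units :=
  exist (fun x => x \is a GRing.unit) _ (units_inv_subproof x).

Lemma units_mulA : associative units_mul.
Proof. by move=> x y z; apply/val_inj; exact: mulrA. Qed.

Lemma units_mul1 : left_id units_one units_mul.
Proof. by move=> x; apply/val_inj; exact: mul1r. Qed.

Lemma units_mulr1 : right_id units_one units_mul.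
Proof. by move=> x; apply/val_inj; exact: mulr1. Qed.

Lemma units_mulV : left_inverse units_one units_inv units_mul.
Proof. by move=> x; apply/val_inj; exact: mulVr (valP x). Qed.

Lemma units_mulrV : right_inverse units_one units_inv units_mul.
Proof. by move=> x; apply/val_inj; exact: mulrV (valP x). Qed.

HB.instance Definition _ := isGroup.Build ring_units
  units_mulA units_mul1 units_mulr1 units_mulV units_mulrV.

Lemma val_units_one : val (1%g : ring_units) = 1.
Proof. by []. Qed.

Lemma val_units_mul (x y : ring_units) : val (x * y)%g = val x * val y.
Proof. by []. Qed.

Lemma val_units_inv (x : ring_units) : val (x^-1)%g = (val x)^-1.
Proof. by []. Qed.

Lemma val_units_exp (x : ring_units) m : val (x ^+ m)%g = val x ^+ m.
Proof. by elim: m => // m IH; rewrite expgS exprS val_units_mul IH. Qed.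

End RingUnits.

(** * Unique roots of unitriangular matrices *)

Section Unitriangular.
Variable N : nat.
Implicit Types a b c d : 'M[rat]_N.+1.

(** [band m d] leaves the entries with [j - i >= m - N]: the shift by [N] keeps
    the index a natural number. Hence [band 0] is no condition, [band N.+1] is
    strict upper triangularity, and only [0] is in [band (N + N).+1]. *)
Definition band (m : nat) d : Prop :=
  forall i j : 'I_N.+1, (j + N < i + m)%N -> d i j = 0.

Definition unitriangular a : Prop := band N.+1 (a - 1).

Lemma bandD m c d : band m c -> band m d -> band m (c + d).
Proof. by move=> bc bd i j ij; rewrite mxE bc // bd // addr0. Qed.

Lemma bandN m d : band m d -> band m (- d).
Proof. by move=> bd i j ij; rewrite mxE bd // oppr0. Qed.

Lemma bandMn m d n : band m d -> band m (d *+ n).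
Proof.
move=> bd; elim: n => [|n IH]; first by move=> i j _; rewrite mulr0n mxE.
by rewrite mulrS; exact: bandD.
Qed.

Lemma band_mul m p q c d : (q + N <= m + p)%N ->
  band m c -> band p d -> band q (c * d).
Proof.
move=> qmp bc bd i j ij; rewrite mxE big1 // => l _.
have [il|il] := ltnP (l + N) (i + m); first by rewrite bc // mul0r.
rewrite bd ?mulr0 //.
by move: qmp ij il; lia.
Qed.

Lemma unitriangular1 : unitriangular 1.
Proof. by move=> i j _; rewrite subrr mxE. Qed.

Lemma unitriangularM a b :
  unitriangular a -> unitriangular b -> unitriangular (a * b).
Proof.
rewrite /unitriangular => ua ub.
have -> : a * b - 1 = (a - 1) * (b - 1) + (a - 1) + (b - 1).
  by rewrite mulrBl mul1r addrAC subrK mulrBr mulr1 addrA subrK.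
apply: bandD => //; apply: bandD => //.
by apply: band_mul ua ub; lia.
Qed.

Lemma unitriangularX a n : unitriangular a -> unitriangular (a ^+ n).
Proof.
move=> ua; elim: n => [|n IH]; first exact: unitriangular1.
by rewrite exprS; exact: unitriangularM.
Qed.

(** Modulo a higher band, a unitriangular factor acts as the identity, so the
    difference of the [n]-th powers is [n] times the lowest band of the
    difference. *)
Lemma unitriangular_subX m a b n : unitriangular a -> unitriangular b ->
  band m (a - b) -> band m.+1 (a ^+ n - b ^+ n - (a - b) *+ n).
Proof.
move=> ua ub bd; elim: n => [|n IH].
  by rewrite subrr mulr0n subr0 => i j _; rewrite mxE.
set d := a - b in bd IH *; set X := (X in band _ X) in IH.
have bm c : band m c -> band m.+1 (c * (b - 1)).
  by move=> bc; apply: band_mul bc ub; lia.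
have -> : a ^+ n.+1 - b ^+ n.+1 - d *+ n.+1 =
    (d *+ n) * (b - 1) + (X * (b - 1) + X) + (a ^+ n - 1) * d.
  have -> : X * (b - 1) + X = X * b by rewrite mulrBr mulr1 subrK.
  rewrite [d *+ n * _]mulrBr mulr1 [_ - d *+ n + _]addrAC -mulrDl.
  rewrite [d *+ n + X]addrC /X subrK mulrBl mulrBl mul1r {4}/d mulrBr -!exprSr.
  rewrite [RHS]addrC -[_ * b - _ - _]addrA [_ - _ - d]addrAC [RHS]addrA subrK.
  by rewrite mulrS opprD !addrA; congr (_ - _); rewrite addrAC.
apply: bandD; last first.
  by apply: band_mul (unitriangularX _ ua) bd; lia.
apply: bandD; first by apply: bm; exact: bandMn.
apply: bandD => //; apply: bm => i j ij; apply: IH.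
by rewrite addnS ltnS ltnW.
Qed.

(** By induction on the band of [a - b]: its lowest part is killed by [n.+1],
    which is invertible in [rat]. *)
Lemma unitriangular_roots a b n : unitriangular a -> unitriangular b ->
  a ^+ n.+1 = b ^+ n.+1 -> a = b.
Proof.
move=> ua ub abn; suff bd m : band m (a - b).
  apply/eqP; rewrite -subr_eq0; apply/eqP/matrixP => i j; rewrite [RHS]mxE.
  apply: (bd (N + N).+1); rewrite addnS ltnS addnA leq_add2r.
  by rewrite (leq_trans _ (leq_addl _ _)) // -ltnS.
elim: m => [|m IH] i j ij.
  by move: ij; rewrite addn0 ltnNge (leq_trans _ (leq_addl _ _)) // -ltnS.
have := @unitriangular_subX m a b n.+1 ua ub IH i j ij.
rewrite abn subrr sub0r mxE => /eqP; rewrite oppr_eq0 -scaler_nat mxE.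
by rewrite mulf_eq0 pnatr_eq0 /= => /eqP.
Qed.

End Unitriangular.

(** * Reduced words in free groups *)

Section Syllables.
Variable F : groupType.
Local Open Scope group_scope.

(** [(s, (a, b))] stands for [s ^+ a / s ^+ b], the power of the letter [s]
    with exponent [a - b] in the integers. *)
Definition syllable : Type := F * (nat * nat).

Definition trivial_syllable : syllable := (1, (0, 0)%N).

Definition syllable_value (u : syllable) : F := u.1 ^+ u.2.1 / u.1 ^+ u.2.2.

Definition word_value (w : seq syllable) : F := \prod_(u <- w) syllable_value u.

Lemma syllable_valueM s a b a' b' :
  syllable_value (s, (a, b)) * syllable_value (s, (a', b')) =
  syllable_value (s, (a + a', b + b')%N).
Proof.
rewrite /syllable_value /= !expgnDr invgM -!mulgA; congr (_ * _).
rewrite !mulgA; have c m n : s ^- m * s ^+ n = s ^+ n * s ^- m.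
  exact/commute_sym/commuteV/commuteX2.
rewrite c -!mulgA; congr (_ * _); apply: commuteV; apply: commute_sym.
by apply: commuteV; exact: commuteX2.
Qed.

Lemma syllable_valueV s a b :
  (syllable_value (s, (a, b)))^-1 = syllable_value (s, (b, a)).
Proof. by rewrite /syllable_value /= invgM invgK. Qed.

Lemma word_valueV w :
  (word_value w)^-1 = word_value (rev [seq (u.1, (u.2.2, u.2.1)) | u <- w]).
Proof.
rewrite /word_value; elim: w => [|[s [a b]] w IH]; first by rewrite !big_nil invg1.
rewrite big_cons invgM IH syllable_valueV /= rev_cons -cats1 big_cat.
by rewrite big_seq1.
Qed.

Definition word_over (S : set F) (w : seq syllable) : Prop :=
  forall u, u \in w -> S u.1.

Lemma free_on_word S x : free_on S ->
  exists2 w, word_over S w & word_value w = x.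
Proof.
move=> freeS; move: x; apply: (free_on_generated freeS).
- by exists [::]; rewrite // /word_value big_nil.
- move=> x y [v Sv <-] [w Sw <-].
  exists (v ++ rev [seq (u.1, (u.2.2, u.2.1)) | u <- w]).
    move=> u; rewrite mem_cat mem_rev => /orP[/Sv //|/mapP[t /Sw St ->]].
    exact: St.
  by rewrite word_valueV /word_value big_cat.
- move=> s Ss; exists [:: (s, (1, 0)%N)].
    by move=> u; rewrite inE => /eqP ->.
  by rewrite /word_value big_seq1 /syllable_value /= expg1 invg1 mulg1.
Qed.

Definition reduced (w : seq syllable) : Prop :=
  (forall i, (i < size w)%N ->
     (nth trivial_syllable w i).2.1 != (nth trivial_syllable w i).2.2) /\
  (forall i, (i.+1 < size w)%N ->
     (nth trivial_syllable w i).1 != (nth trivial_syllable w i.+1).1).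

(** A word with the least number of syllables is reduced: a trivial syllable
    could be dropped, and two neighbours on one letter could be merged. *)
Lemma free_on_reduced_word S x : free_on S ->
  exists w, [/\ word_over S w, reduced w & word_value w = x].
Proof.
move=> freeS.
pose P k := `[< exists w, [/\ word_over S w, size w = k & word_value w = x] >].
have exP : exists k, P k.
  have [w Sw wx] := free_on_word x freeS.
  by exists (size w); apply/asboolP; exists w.
case: (ex_minnP exP) => k /asboolP[w [Sw wk wx]] kmin.
exists w; split=> //; split=> i iw.
- apply/negP => /eqP e.
  have wE : w = take i w ++ drop i w by rewrite cat_take_drop.
  rewrite (drop_nth trivial_syllable) // in wE.
  suff /kmin : P (size w).-1 by move: iw wk; lia.
  apply/asboolP; exists (take i w ++ drop i.+1 w); split.
  + move=> u; rewrite mem_cat => /orP[/mem_take/Sw //|/mem_drop/Sw //].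
  + by rewrite size_cat size_take size_drop iw; lia.
  + rewrite -wx [in RHS]wE /word_value !big_cat big_cons /=; congr (_ * _).
    by rewrite /syllable_value e mulgV mul1g.
- apply/negP => /eqP e.
  have wE : w = take i w ++ drop i w by rewrite cat_take_drop.
  rewrite (drop_nth trivial_syllable (ltnW iw)) in wE.
  rewrite (drop_nth trivial_syllable iw) in wE.
  set u := nth _ w i in e wE; set v := nth _ w i.+1 in e wE.
  suff /kmin : P (size w).-1 by move: iw wk; lia.
  apply/asboolP.
  exists (take i w ++ (u.1, (u.2.1 + v.2.1, u.2.2 + v.2.2)%N) :: drop i.+2 w); split.
  + move=> t; rewrite mem_cat => /orP[/mem_take/Sw //|].
    rewrite inE => /orP[/eqP -> /=|/mem_drop/Sw //].
    by apply: Sw; apply: mem_nth; exact: ltnW.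
  + by rewrite size_cat /= size_take size_drop (ltnW iw); lia.
  + rewrite -wx [in RHS]wE /word_value !big_cat !big_cons /= mulgA.
    rewrite -syllable_valueM -mulgA.
    by move: e; case: (u) => ? [? ?]; case: (v) => ? [? ?] /= ->; rewrite -!mulgA.
Qed.

End Syllables.

(** * Unitriangular representations of free groups *)

Section LetterMatrices.
Variables (F : groupType) (w : seq (syllable F)).
Let k := size w.
Let letter i := (nth (trivial_syllable F) w i).1.

(** The letter [s] moves position [i] to [i.+1] exactly where it is the [i]-th
    letter of [w]. *)
Definition letter_mx (s : F) : 'M[rat]_k.+1 :=
  \matrix_(i, j) ((j == i.+1 :> nat) && (letter i == s))%:R.

Lemma letter_mx_band s : band k.+1 (letter_mx s).
Proof.
move=> i j ij; rewrite mxE; case: eqP => //= jE.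
by move: ij; rewrite jE; lia.
Qed.

Hypothesis redw : reduced w.

(** Two moves by one letter would need it twice in a row in [w]. *)
Lemma letter_mx_sqr s : letter_mx s * letter_mx s = 0.
Proof.
apply/matrixP => i j; rewrite !mxE big1 // => l _; rewrite !mxE.
have [/= lE|_] := (l =P i.+1 :> nat); last by rewrite mul0r.
have [/= js|_] := (letter i =P s); last by rewrite mul0r.
have [/= jE|_] := (j =P l.+1 :> nat); last by rewrite mulr0.
rewrite mul1r; case: eqP => // ls.
have ik : (i.+1 < k)%N by rewrite -ltnS -lE -jE ltn_ord.
by have /eqP[] := redw.2 i ik; rewrite -/(letter i) -/(letter i.+1) js -lE ls.
Qed.

Lemma letter_mx_expD s m : (1 + letter_mx s) ^+ m = 1 + letter_mx s *+ m.
Proof.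
elim: m => [|m IH]; first by rewrite mulr0n addr0.
rewrite exprS IH mulrDl mul1r mulrDr mulr1 mulrnAr letter_mx_sqr mul0rn addr0.
by rewrite -addrA -mulrSr.
Qed.

Lemma letter_mx_unitr s (c : rat) :
  (1 + c *: letter_mx s) * (1 - c *: letter_mx s) = 1.
Proof.
rewrite mulrDl mul1r mulrBr mulr1 -scalerAl -scalerAr letter_mx_sqr.
by rewrite !scaler0 subr0 subrK.
Qed.

Lemma letter_mx_unit s (c : rat) :
  1 + c *: letter_mx s \is a GRing.unit.
Proof.
apply/unitrP; exists (1 - c *: letter_mx s); split; last exact: letter_mx_unitr.
by have := letter_mx_unitr s (- c); rewrite scaleNr opprK.
Qed.

Lemma letter_mx_inv s (c : rat) :
  (1 + c *: letter_mx s)^-1 = 1 - c *: letter_mx s.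
Proof.
by apply: (mulrI (letter_mx_unit s c)); rewrite letter_mx_unitr mulrV // letter_mx_unit.
Qed.

Definition letter_unit (s : F) : ring_units 'M[rat]_k.+1 :=
  exist (fun x => x \is a GRing.unit) _ (letter_mx_unit s 1).

Lemma val_letter_unit s : val (letter_unit s) = 1 + letter_mx s.
Proof. by rewrite /= scale1r. Qed.

Lemma letter_unit_unitriangular s : unitriangular (val (letter_unit s)).
Proof. by rewrite /unitriangular val_letter_unit addrC addKr; exact: letter_mx_band. Qed.

Lemma letter_unitV_unitriangular s :
  unitriangular (val (letter_unit s)^-1%g).
Proof.
rewrite /unitriangular val_units_inv /= letter_mx_inv scale1r addrC addKr.
exact/bandN/letter_mx_band.
Qed.

Lemma val_letter_syllable s a b :
  val (letter_unit s ^+ a / letter_unit s ^+ b)%g =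
  1 + (a%:R - b%:R) *: letter_mx s.
Proof.
rewrite val_units_mul val_units_inv !val_units_exp val_letter_unit.
rewrite !letter_mx_expD -!scaler_nat letter_mx_inv mulrDl mul1r mulrBr mulr1.
rewrite -scalerAl -scalerAr letter_mx_sqr !scaler0 subr0 scalerBl -addrA addrC.
by rewrite addrA [_ + 1]addrC addrAC addrA.
Qed.

(** Row [0] of the product of the first [t] factors ends in column [t], where
    it holds the product of the exponents: each new factor can move the last
    entry one column to the right. *)
Lemma letter_mx_prod (c : nat -> rat) t : (t <= k)%N ->
  let A := \prod_(0 <= i < t) (1 + c i *: letter_mx (letter i)) in
  forall l : 'I_k.+1, (t <= l)%N ->
    A ord0 l = (l == t :> nat)%:R * \prod_(0 <= i < t) c i.
Proof.
elim: t => [|t IH] tk /= l tl.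
  by rewrite !big_geq // mulr1 mxE; congr (_%:R); rewrite -val_eqE /= eq_sym.
rewrite big_nat_recr //= [in RHS]big_nat_recr //= mulrDr mulr1 -scalerAr.
set A := \prod_(_ <= _ < _) _ in IH *.
rewrite mxE IH ?(ltnW tl) //; last exact: ltnW.
rewrite (gtn_eqF tl) mul0r add0r mxE mxE.
have tk1 : (t < k.+1)%N by rewrite ltnW.
rewrite (bigD1 (Ordinal tk1)) //= big1 ?addr0; last first.
  move=> j jt; rewrite !mxE; have [jl|lj] := ltnP t j.
    by rewrite (IH (ltnW tk) j (ltnW jl)) (gtn_eqF jl) !mul0r.
  case: eqP => [le|] /=; last by rewrite mulr0.
  move: jt; rewrite -val_eqE /= => /eqP; case; apply/eqP.
  by rewrite eqn_leq lj /= -ltnS -le.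
rewrite (IH (ltnW tk) (Ordinal tk1) (leqnn t)) /= eqxx mul1r.
by rewrite mxE /= eqxx andbT mulrC mulrAC mulrC.
Qed.

End LetterMatrices.

(** * Roots and commutation in residually free groups *)

Section FreeGroupRoots.
Local Open Scope group_scope.

(** A reduced word of [x] yields the representation sending each letter [s] to
    [1 + letter_mx s]; the corner coefficient of the image of [x] is the product
    of the exponents of the word, hence nonzero. *)
Lemma free_on_unitriangular (F : groupType) (S : set F) (x : F) :
  free_on S -> x != 1 ->
  exists k (f : {multiplicative F -> ring_units 'M[rat]_k.+1}),
    (forall y, unitriangular (val (f y))) /\ f x != 1.
Proof.
move=> freeS x1; have [w [Sw redw wx]] := free_on_reduced_word x freeS.
have [[f fE] _] := freeS _ (letter_unit redw).
exists (size w), f; split=> [y|].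
  (* the inverses are carried along, so that no inverse of a unitriangular
     matrix has to be computed *)
  pose P y := unitriangular (val (f y)) /\ unitriangular (val (f y)^-1).
  suff : P y by case.
  move: y; apply: (free_on_generated freeS).
  - rewrite /P multiplicative_one invg1 val_units_one.
    by split; exact: unitriangular1.
  - move=> y z [y1 y2] [z1 z2]; rewrite /P gmulfM multiplicative_inv.
    by rewrite invgM invgK !val_units_mul; split; exact: unitriangularM.
  - move=> s Ss; rewrite /P fE //; split.
      exact: letter_unit_unitriangular.
    exact: letter_unitV_unitriangular.
set c := fun i => ((nth (trivial_syllable F) w i).2.1%:R -
                   (nth (trivial_syllable F) w i).2.2%:R)%R : rat.
have fxE : val (f x) = (\prod_(0 <= i < size w)
    (1 + c i *: letter_mx w (nth (trivial_syllable F) w i).1))%R.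
  rewrite -wx /word_value (big_nth (trivial_syllable F)) big_nat.
  rewrite (big_morph f (@gmulfM _ _ f) (multiplicative_one f)).
  rewrite (big_morph (fun u : ring_units _ => val u) (@val_units_mul _) (val_units_one _)).
  rewrite -big_nat; apply: eq_big_nat => i iw.
  rewrite /syllable_value gmulfM multiplicative_inv !multiplicative_exp fE.
    exact: val_letter_syllable.
  by apply: Sw; exact: mem_nth.
have w0 : (0 < size w)%N.
  rewrite lt0n; apply: contra_neqN x1 => /eqP/size0nil w0.
  by rewrite -wx w0 /word_value big_nil.
apply/eqP => /(congr1 val); rewrite fxE => /matrixP/(_ ord0 ord_max).
rewrite (letter_mx_prod c (leqnn _)) //= eqxx mul1r mxE -val_eqE /= eqn_leq.
rewrite [(_ <= 0)%N]leqNgt w0 andbF => /eqP; apply/negP.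
rewrite prodf_seq_neq0; apply/allP => i; rewrite mem_index_iota => /andP[_ iw].
apply/implyP => _; rewrite subr_eq0 eqr_nat; exact: redw.1.
Qed.

Lemma free_group_root_inj (F : groupType) n (x y : F) :
  free_group F -> x ^+ n.+1 = y ^+ n.+1 -> x = y.
Proof.
move=> [S freeS] xy; apply/eqP; rewrite -divg_eq1; apply/negPn/negP => xy1.
have [k [f [uf /eqP[]]]] := free_on_unitriangular freeS xy1.
rewrite gmulfM multiplicative_inv; suff -> : f x = f y by rewrite mulgV.
apply: val_inj; apply: (@unitriangular_roots k _ _ n); try exact: uf.
by rewrite -!val_units_exp -!multiplicative_exp xy.
Qed.

(** The conjugate of [x] by [y] has the same power as [x]. *)
Lemma free_group_commute_root (F : groupType) n (x y : F) :
  free_group F -> commute (x ^+ n.+1) y -> commute x y.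
Proof.
move=> freeF xy; apply/commgP/conjg_fixP; apply: (free_group_root_inj (n := n)) => //.
by rewrite -conjXg; apply/conjg_fixP/commgP.
Qed.

(** A free group that detects the commutator of [x] and [y] would contradict
    [free_group_commute_root]. *)
Lemma residually_free_commute_root (G : groupType) n (x y : G) :
  residually_free G -> commute (x ^+ n.+1) y -> commute x y.
Proof.
move=> resG xy; apply/commgP/negPn/negP => /resG[F [f [freeF /eqP[]]]].
rewrite /commg /conjg !gmulfM !multiplicative_inv; apply/eqP/commgP.
apply: (@free_group_commute_root _ n) => //.
by rewrite /commute -multiplicative_exp -!gmulfM xy.
Qed.

Lemma residually_free_sub (G H : groupType) (f : {multiplicative H -> G}) :
  injective f -> residually_free G -> residually_free H.
Proof.
move=> injf resG x x1.
have /resG[F [g [freeF gfx]]] : f x != 1.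
  by apply: contra_neq x1; rewrite -(multiplicative_one f) => /injf.
have gfM : {morph g \o f : y z / y * z} by move=> y z /=; rewrite !gmulfM.
pose gf : {multiplicative H -> F} :=
  HB.pack (g \o f) (isMultiplicative.Build H F _ gfM).
by exists F, gf.
Qed.

End FreeGroupRoots.

(** * Coverings and the lifting of homotopies *)

Section IntervalInduction.
Variable R : realType.

(** The supremum of the [t] with [P 0 t] is reached and cannot be less than
    [1]. *)
Lemma interval_induction (P : R -> R -> Prop) :
  (forall a b c, a <= b -> b <= c -> P a b -> P b c -> P a c) ->
  (forall t, exists2 e, 0 < e &
     forall a b, t - e <= a -> a <= b -> b <= t + e -> P a b) ->
  P 0 1.
Proof.
move=> Ptrans Ploc; pose A := [set t | 0 <= t <= 1 /\ P 0 t].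
have A0 : A 0.
  split; first by rewrite lexx ler01.
  by have [e e0 +] := Ploc 0; apply; lra.
have hA : has_sup A by split; [exists 0|exists 1 => t [/andP[]]].
have s0 : 0 <= sup A by exact: sup_upper_bound.
have s1 : sup A <= 1 by apply: ge_sup; [exists 0|move=> t [/andP[]]].
have [e e0 Pe] := Ploc (sup A).
have [t [/andP[t0 t1] Pt] st] := sup_adherent e0 hA.
have ts : t <= sup A by apply: sup_upper_bound => //; split=> //; rewrite t0.
have [h|h] := leP 1 (sup A + e).
  by apply: (Ptrans _ t) => //; apply: Pe; lra.
suff : sup A + e <= sup A by lra.
apply: sup_upper_bound => //; split; first by lra.
by apply: (Ptrans _ t) => //; [lra|apply: Pe; lra].
Qed.

Definition retract (a b t : R) : R := Num.max a (Num.min t b).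

Lemma retract_continuous a b : continuous (retract a b).
Proof.
move=> x.
apply: (@continuous_max R R (cst a) (fun t => Num.min t b)); first exact: cst_continuous.
by apply: (@continuous_min R R id (cst b)); [exact: cvg_id|exact: cst_continuous].
Qed.

Lemma retract_id a b t : a <= t <= b -> retract a b t = t.
Proof. by case/andP=> ta tb; rewrite /retract min_l // max_r. Qed.

Lemma retract_itv a b t : a <= b -> a <= retract a b t <= b.
Proof. by move=> ab; rewrite /retract le_max lexx /= ge_max ab ge_min lexx orbT. Qed.

Lemma retract_left a b t : a <= b -> t <= a -> retract a b t = a.
Proof. by move=> ab ta; rewrite /retract max_l // ge_min ta. Qed.

Lemma retract_right a b t : a <= b -> b <= t -> retract a b t = b.
Proof. by move=> ab tb; rewrite /retract min_r // max_r. Qed.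

Lemma retract_split a b c t : a <= b -> b <= c ->
  retract a c t = if t <= b then retract a b t else retract b c t.
Proof.
move=> ab bc; case: (leP t b) => tb.
  by rewrite /retract !min_l // (le_trans tb bc).
case: (leP t c) => tc.
  by rewrite !retract_id //; lra.
by rewrite !retract_right // ?(le_trans ab bc) // ltW.
Qed.

End IntervalInduction.

Section Covering.
Variables (R : realType) (E X : topologicalType) (p : E -> X).

(** Over a neighbourhood [V] that depends on [x] only, sections pass through all
    points above [V]. This is what evenly covered neighbourhoods are used for in
    the lifting of maps. *)
Definition covering : Prop :=
  (forall e : E, exists2 U, nbhs e U &
     forall e1 e2, U e1 -> U e2 -> p e1 = p e2 -> e1 = e2) /\
  (forall x : X, exists2 V, nbhs x V &
     forall e, V (p e) -> exists s : X -> E,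
       [/\ forall y, V y -> {for y, continuous s}, s (p e) = e
         & forall y, V y -> p (s y) = y]).

Hypotheses (E_hausdorff : hausdorff_space E) (p_covering : covering).

(** Two lifts agree on a set which is open by local injectivity and closed by
    separation. *)
Lemma lift_unique (T : topologicalType) (f g : T -> E) (t0 : T) :
  connected [set: T] -> continuous f -> continuous g ->
  (forall t, p (f t) = p (g t)) -> f t0 = g t0 -> f =1 g.
Proof.
move=> cT cf cg pfg fg0.
suff /seteqP[_ AT] : [set t | f t = g t] = [set: T] by move=> t; exact: (AT t Logic.I).
apply: cT; first by exists t0.
- exists [set t | f t = g t]; last by rewrite setTI.
  rewrite openE => t /= ft; have [U nU injU] := p_covering.1 (f t).
  have nUg : nbhs t (g @^-1` U) by apply: cg; rewrite -ft.
  have nUf : nbhs t (f @^-1` U) := cf t _ nU.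
  rewrite /interior; apply: (filterS _ (filterI nUf nUg)) => s [/= fs gs].
  exact: injU (pfg s).
- exists [set t | f t = g t]; last by rewrite setTI.
  rewrite -[X in closed X]setCK; apply: open_closedC.
  rewrite openE => t /= /eqP ft; move: E_hausdorff; rewrite open_hausdorff.
  move=> /(_ _ _ ft)[[A B] /= [/set_mem At /set_mem Bt] [oA oB /eqP AB]].
  have nA : nbhs t (f @^-1` A) by apply: cf; exact: open_nbhs_nbhs.
  have nB : nbhs t (g @^-1` B) by apply: cg; exact: open_nbhs_nbhs.
  rewrite /interior; apply: (filterS _ (filterI nA nB)) => s [/= fs gs] fgs.
  by rewrite -[False]/((set0 : set E) (f s)) -AB; split=> //; rewrite fgs.
Qed.

Definition liftable (T : topologicalType) (H : T -> X) : Prop :=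
  forall t e, p e = H t ->
    exists f : T -> E, [/\ continuous f, f t = e & forall u, p (f u) = H u].

Lemma liftable_ext (T : topologicalType) (H K : T -> X) :
  H =1 K -> liftable H -> liftable K.
Proof.
move=> HK lH t e pe; have [|f [cf ft pf]] := lH t e; first by rewrite HK.
by exists f; split=> // u; rewrite -HK.
Qed.

Lemma liftable_swap (T U : topologicalType) (H : T * U -> X) :
  liftable H -> liftable (fun q : U * T => H (q.2, q.1)).
Proof.
move=> lH [u t] e /= pe; have [f [cf ft pf]] := lH (t, u) e pe.
exists (fun q => f (q.2, q.1)); split=> //.
exact: (comp_continuous
  (pair_continuous (@snd_continuous _ _) (@fst_continuous _ _)) cf).
Qed.

Lemma real_connected : connected [set: R].
Proof. exact/connected_intervalP. Qed.

(** The second lift is chosen to agree with the first at one point of the common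
    edge; then they agree on the whole edge, which is connected. *)
Lemma liftable_glue (Y : topologicalType) (H : Y * R -> X) a b c :
  connected [set: Y] -> a <= b -> b <= c ->
  liftable (fun q => H (q.1, retract a b q.2)) ->
  liftable (fun q => H (q.1, retract b c q.2)) ->
  liftable (fun q => H (q.1, retract a c q.2)).
Proof.
move=> cY ab bc lab lbc.
have glue (f g : Y * R -> E) y : continuous f -> continuous g ->
    (forall q, p (f q) = H (q.1, retract a b q.2)) ->
    (forall q, p (g q) = H (q.1, retract b c q.2)) -> f (y, b) = g (y, b) ->
    let h := fun q : Y * R => if q.2 <= b then f q else g q in
    continuous h /\ (forall q, p (h q) = H (q.1, retract a c q.2)).
  move=> cf cg pf pg fg h; split; last first.
    by move=> q; rewrite (retract_split _ ab bc) /h; case: ifP => _; rewrite ?pf ?pg.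
  apply: continuous_if_le => //; first exact: snd_continuous.
  move=> [z t] /= ->; have cb : continuous (fun z : Y => (z, b)).
    by apply: pair_continuous => ?; [exact: cvg_id|exact: cvg_cst].
  apply: (lift_unique (t0 := y) cY (comp_continuous cb cf) (comp_continuous cb cg)) => //.
  by move=> u; rewrite pf pg /= (retract_left bc) // (retract_right ab).
move=> [y t] e /= pe.
have [tb|bt] := leP t b.
  have [|f [cf ft pf]] := lab (y, t) e.
    by rewrite pe (retract_split _ ab bc) tb.
  have [|g [cg gb pg]] := lbc (y, b) (f (y, b)).
    by rewrite pf /= (retract_left bc) // (retract_right ab).
  have [ch ph] := glue f g y cf cg pf pg (esym gb).
  by exists (fun q => if q.2 <= b then f q else g q); split=> //=; rewrite tb.
have [|g [cg gt pg]] := lbc (y, t) e.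
  by rewrite pe (retract_split _ ab bc) leNgt bt.
have [|f [cf fb pf]] := lab (y, b) (g (y, b)).
  by rewrite pg /= (retract_left bc) // (retract_right ab).
have [ch ph] := glue f g y cf cg pf pg fb.
by exists (fun q => if q.2 <= b then f q else g q); split=> //=; rewrite leNgt bt.
Qed.

Lemma liftable_box (H : R * R -> X) s t : continuous H ->
  exists2 e, 0 < e & forall a b c d,
    s - e <= a -> a <= b -> b <= s + e -> t - e <= c -> c <= d -> d <= t + e ->
    liftable (fun q => H (retract a b q.1, retract c d q.2)).
Proof.
move=> cH; have [V nV sV] := p_covering.2 (H (s, t)).
have /nbhs_ballP[e /= e0 eV] := cH _ _ nV.
exists (e / 2); first by rewrite divr_gt0.
move=> a b c d sa ab bs tc cd dt.
have HV q : V (H (retract a b q.1, retract c d q.2)).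
  have /andP[? ?] := retract_itv q.1 ab; have /andP[? ?] := retract_itv q.2 cd.
  by apply: eV; split; rewrite /ball /= ltr_norml; apply/andP; split; lra.
move=> q x px; have [|f [cf fx pf]] := sV x; first by rewrite px.
have cr : continuous (fun u : R * R => H (retract a b u.1, retract c d u.2)).
  apply: comp_continuous cH; apply: pair_continuous.
    exact: comp_continuous (@fst_continuous _ _) (@retract_continuous _ _ _).
  exact: comp_continuous (@snd_continuous _ _) (@retract_continuous _ _ _).
exists (fun u => f (H (retract a b u.1, retract c d u.2))); split.
- by move=> u; apply: continuous_comp; [exact: cr|exact/cf/HV].
- by rewrite -px.
- by move=> u; exact/pf/HV.
Qed.

(** Boxes are glued to thin horizontal strips, which are then stacked. *)
Lemma liftable_square (H : R * R -> X) : continuous H ->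
  liftable (fun q => H (retract 0 1 q.1, retract 0 1 q.2)).
Proof.
move=> cH.
have strip t : exists2 e, 0 < e & forall c d, t - e <= c -> c <= d -> d <= t + e ->
    liftable (fun q => H (retract 0 1 q.1, retract c d q.2)).
  pose P a b := exists2 e, 0 < e & forall c d,
    t - e <= c -> c <= d -> d <= t + e ->
    liftable (fun q => H (retract a b q.1, retract c d q.2)).
  apply: (@interval_induction R P).
    move=> a b c ab bc [e1 e10 l1] [e2 e20 l2].
    have e1m : Num.min e1 e2 <= e1 by rewrite ge_min lexx.
    have e2m : Num.min e1 e2 <= e2 by rewrite ge_min lexx orbT.
    exists (Num.min e1 e2); first by rewrite lt_min e10.
    move=> u v tu uv vt; pose K (q : R * R) := H (q.2, retract u v q.1).
    apply: (@liftable_ext _ (fun q : R * R => K (q.2, retract a c q.1))) => //.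
    apply: (@liftable_swap _ _ (fun q : R * R => K (q.1, retract a c q.2))).
    apply: (liftable_glue real_connected ab bc).
      apply: (@liftable_swap _ _ (fun q : R * R => K (q.2, retract a b q.1))).
      by apply: l1; lra.
    apply: (@liftable_swap _ _ (fun q : R * R => K (q.2, retract b c q.1))).
    by apply: l2; lra.
  move=> s; have [e e0 le] := liftable_box s t cH.
  exists e => // a b sa ab bs; exists e => // c d tc cd dt.
  exact: le.
apply: (@interval_induction R (fun c d =>
  liftable (fun q => H (retract 0 1 q.1, retract c d q.2)))) => //.
move=> a b c ab bc l1 l2.
by apply: (@liftable_glue _ (fun q : R * R => H (retract 0 1 q.1, q.2)) a b c
  real_connected).
Qed.

Local Notation I := (unit_interval R).

(** The lift of a homotopy is constant on the two sides where the homotopy is,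
    and restricts to the given lifts on the two others. *)
Lemma monodromy (x y : X) (e0 e1 e2 : E) (P Q : {path I from x to y})
    (f : {path I from e0 to e1}) (g : {path I from e0 to e2}) :
  path_homotopic P Q -> (forall t, p (f t) = P t) -> (forall t, p (g t) = Q t) ->
  e1 = e2.
Proof.
case=> H [cH H0 H1] pf pg.
pose K (q : R * R) := H (clamp q.1, clamp q.2).
have cK : continuous K.
  apply: comp_continuous cH; apply: pair_continuous.
    exact: comp_continuous (@fst_continuous _ _) (@clamp_continuous R).
  exact: comp_continuous (@snd_continuous _ _) (@clamp_continuous R).
have cr (t : R) : clamp (retract 0 1 t) = clamp t.
  by apply: unit_interval_inj; rewrite val_clamp ?retract_itv.
have pe0 : p e0 = x by have := pf zero; rewrite !path_zero.
have [|h [ch h0 ph]] := liftable_square cK (t := (0, 0)) (e := e0).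
  by rewrite /K /= !cr (H0 zero).1 path_zero.
have {}ph q : p (h q) = H (clamp q.1, clamp q.2) by rewrite ph /K /= !cr.
have row (T : topologicalType) (u v : T -> R) : continuous u -> continuous v ->
    continuous (fun t => h (u t, v t)).
  by move=> cu cv; apply: comp_continuous ch; exact: pair_continuous.
have cid : continuous (fun t : R => t) by move=> ?; exact: cvg_id.
have ccst (c : R) : continuous (fun t : R => c) by move=> ?; exact: cvg_cst.
have cst_lift (c : R) : (forall t, p (h (c, t)) = p (h (c, 0))) ->
    forall t, h (c, t) = h (c, 0).
  move=> pc; apply: (@lift_unique _ (fun t => h (c, t)) (fun=> h (c, 0)) 0) => //.
  - exact: real_connected.
  - exact: row.
  - by move=> ?; exact: cvg_cst.
have Hl t : H (clamp 0, t) = x := (H1 t).1.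
have Hr t : H (clamp 1, t) = y := (H1 t).2.
have left t : h (0, t) = e0.
  rewrite cst_lift ?h0 // => {}t.
  by rewrite !ph /= !Hl.
have right t : h (1, t) = h (1, 0).
  by rewrite cst_lift // => {}t; rewrite !ph /= !Hr.
have side (e' : E) (F : {path I from e0 to e'}) (c : R) :
    (forall t, p (F t) = H (t, clamp c)) -> h (1, c) = e'.
  move=> pF; rewrite -(extend_path_ge1 F (lexx 1)).
  apply: (@lift_unique _ (fun t => h (t, c)) (extend_path F) 0 real_connected).
  - exact: row.
  - exact: extend_path_continuous.
  - by move=> t; rewrite ph /extend_path pF.
  - by rewrite left extend_path_le0.
rewrite -(side _ f 0); last by move=> t; rewrite pf (H0 t).1.
by rewrite -(right 1) (side _ g 1) // => t; rewrite pg (H0 t).2.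
Qed.

End Covering.

(** A locally injective open surjection whose fibres are orbits of continuous
    deck maps: a section over the image of a small set [U], moved by a deck map,
    passes through any prescribed point. *)
Lemma covering_of_deck (E X : topologicalType) (p : E -> X) :
  (forall x, exists e, p e = x) ->
  (forall (e : E) U, nbhs e U -> nbhs (p e) (p @` U)) ->
  (forall e : E, exists2 U, nbhs e U &
     forall e1 e2, U e1 -> U e2 -> p e1 = p e2 -> e1 = e2) ->
  (forall e e', p e = p e' -> exists d : E -> E,
     [/\ continuous d, d e = e' & forall x, p (d x) = p x]) ->
  covering p.
Proof.
move=> surjp openp injp deck; split=> // x.
have [e0 pe0] := surjp x; have [U + injU] := injp e0.
rewrite nbhsE => -[W [oW We0] WU].
exists (p @` W); first by rewrite -pe0; apply: openp; exact: open_nbhs_nbhs.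
pose tau y := xget e0 [set u | W u /\ p u = y].
have tauP y : (p @` W) y -> W (tau y) /\ p (tau y) = y.
  by move=> [u Wu pu]; rewrite /tau; case: xgetP => [v -> //|/(_ u)[]].
have tauE u : W u -> tau (p u) = u.
  move=> Wu; have [|Wt pt] := tauP (p u); first by exists u.
  by apply: injU pt; exact: WU.
move=> e [u Wu pu]; have [d [cd du pd]] := deck u e pu.
exists (d \o tau); split.
- move=> y Vy; apply: continuous_comp; last exact: cd.
  have [Wt pt] := tauP y Vy => A nA.
  have nAW : nbhs (tau y) (W `&` A) by apply: filterI nA; exact: open_nbhs_nbhs.
  have := openp _ _ nAW; rewrite pt; apply: filterS => _ [v [Wv Av] <-] /=.
  by rewrite tauE.
- by rewrite /= -pu tauE.
- by move=> y Vy; rewrite /= pd; have [] := tauP y Vy.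
Qed.

(** * Continuity of complex powers and roots *)

Section ComplexContinuity.
Variable R : realType.
Local Notation C := (complexes R).

Lemma real_complex_continuous : continuous (fun x : R => x%:C%C : C).
Proof.
move=> x; apply/cvgrPdist_lt => /= e; rewrite ltcE /= => /andP[/eqP e0 er].
near=> y; rewrite -rmorphB /= normc_def /= expr0n /= addr0 sqrtr_sqr.
rewrite ltcE /= e0 eqxx /=.
near: y; apply: cvgr_dist_lt => //; exact: cvg_id.
Unshelve. all: by end_near. Qed.

Lemma continuousM_complex (T : topologicalType) (f g : T -> C) :
  continuous f -> continuous g -> continuous (fun t => f t * g t).
Proof. by move=> cf cg t; apply: cvgM; [exact: cf|exact: cg]. Qed.

Lemma continuousX_complex (T : topologicalType) (f : T -> C) k :
  continuous f -> continuous (fun t => f t ^+ k).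
Proof.
move=> cf; elim: k => [|k IH].
  by under eq_fun do rewrite expr0; exact: cst_continuous.
by under eq_fun do rewrite exprS; exact: continuousM_complex.
Qed.

Lemma near_neq0 (T : topologicalType) (f : T -> C) t :
  continuous f -> f t != 0 -> \forall s \near t, f s != 0.
Proof.
move=> cf ft; have : 0 < `|f t| by rewrite normr_gt0.
move=> /(@cvgr_dist_lt _ _ _ _ _ _ _ (cf t)); apply: filterS => s.
by apply: contraTneq => ->; rewrite subr0 ltxx.
Qed.

Lemma mx_continuous (T : topologicalType) k l (f : T -> 'M[C]_(k, l)) :
  (forall i j, continuous (fun t => f t i j)) -> continuous f.
Proof.
move=> cf t A [P nP PA].
have : \forall s \near t, forall ij : 'I_k * 'I_l, P ij.1 ij.2 (f s ij.1 ij.2).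
  by apply: filter_forall => -[i j] /=; exact: (cf i j t _ (nP i j)).
by apply: filterS => s Ps; apply: PA => i j; exact: (Ps (i, j)).
Qed.

(** Roots depend continuously on the radicand: the distances from [c] to the
    [k]-th roots of [u] multiply to the distance from [c ^+ k] to [u]. *)
Lemma near_root (c : C) k (P : set C) : (0 < k)%N -> nbhs c P ->
  \forall u \near c ^+ k, exists2 d, P d & d ^+ k = u.
Proof.
move=> k0 /nbhs_normP[e /= e0 eP].
have ek : 0 < e ^+ k by rewrite exprn_gt0.
apply/nbhs_normP; exists (e ^+ k) => //= u cu.
have [rs rsE] := closed_field_poly_normal ('X^k - u%:P : {poly C}).
have /monicP lc1 : ('X^k - u%:P : {poly C}) \is monic by rewrite monicXnsubC.
rewrite lc1 scale1r in rsE.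
have srs : size rs = k.
  by have := size_XnsubC u k0; rewrite rsE size_prod_XsubC => -[].
have [/hasP[d drs cd]|/hasPn far] := boolP (has (fun d => `|c - d| < e) rs).
  exists d; first exact: eP.
  have : root ('X^k - u%:P) d by rewrite rsE root_prod_XsubC.
  by rewrite /root !hornerE subr_eq0 => /eqP.
have : ('X^k - u%:P).[c] = \prod_(d <- rs) (c - d).
  by rewrite rsE horner_prod; apply: eq_bigr => d _; rewrite !hornerE.
rewrite !hornerE => cE; rewrite /ball_ /= cE normr_prod in cu.
suff ek_le : e ^+ k <= \prod_(d <- rs) `|c - d|.
  by have := le_lt_trans ek_le cu; rewrite ltxx.
rewrite -srs; elim: rs far {srs rsE cE cu} => [|d rs IH] far.
  by rewrite big_nil expr0.
rewrite big_cons exprS; apply: ler_pM; [exact: ltW|exact/exprn_ge0/ltW| |].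
  have /= := far d (mem_head _ _); rewrite -real_leNgt //; exact: gtr0_real.
by apply: IH => x xrs; apply: far; rewrite inE xrs orbT.
Qed.

(** Near a point whose coordinates are nonzero with distinct [m]-th powers, the
    unordered tuple of [m]-th powers determines the coordinates: no permutation
    of the powers is possible, and [x ^+ m = y ^+ m] forces [x = y] because the
    cofactor of [x - y] stays close to [m * x ^+ m.-1]. *)
Lemma power_locally_injective n m (E : topologicalType) (c : E -> 'I_n -> C)
    (e : E) : (0 < m)%N -> (forall i, continuous (fun x => c x i)) ->
  (forall i, c e i != 0) -> (forall i j, c e i ^+ m = c e j ^+ m -> i = j) ->
  exists2 U, nbhs e U & forall e1 e2 (s : {perm 'I_n}), U e1 -> U e2 ->
    (forall i, c e2 i ^+ m = c e1 (s i) ^+ m) -> forall i, c e1 i = c e2 i.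
Proof.
move=> m0 cc c0 cinj.
pose S (q : E * E) i := \sum_(j < m) c q.2 i ^+ (m.-1 - j) * c q.1 i ^+ j.
have c1 i : continuous (fun q : E * E => c q.1 i).
  exact: (comp_continuous (@fst_continuous _ _) (cc i)).
have c2 i : continuous (fun q : E * E => c q.2 i).
  exact: (comp_continuous (@snd_continuous _ _) (cc i)).
have FF : Filter (nbhs ((e, e) : E * E)) := nbhs_filter ((e, e) : E * E).
have near1 : \forall q \near ((e, e) : E * E), forall ij : 'I_n * 'I_n,
    ij.1 != ij.2 -> c q.2 ij.1 ^+ m - c q.1 ij.2 ^+ m != 0.
  apply: (filter_forall FF) => -[i j] /=; have [->|ij] := eqVneq i j.
    by apply: nearW.
  have : \forall q \near ((e, e) : E * E), c q.2 i ^+ m - c q.1 j ^+ m != 0.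
    apply: near_neq0.
      by move=> q; apply: cvgB; exact: continuousX_complex.
    by rewrite subr_eq0; apply: contra_neq ij => /cinj.
  by apply: filterS.
have near2 : \forall q \near ((e, e) : E * E), forall i, S q i != 0.
  apply: (filter_forall FF) => i; apply: (@near_neq0 _ (S^~ i) ((e, e) : E * E)).
    move=> q; apply: cvg_big => [|j _]; first exact: add_continuous.
    have h := continuousM_complex (continuousX_complex (k := m.-1 - j) (c2 i))
      (continuousX_complex (k := j) (c1 i)).
    exact: (h q).
  rewrite /S /= (eq_bigr (fun=> c e i ^+ m.-1)) => [|j _].
    rewrite sumr_const card_ord -mulr_natr mulf_neq0 ?expf_neq0 //.
    by rewrite pnatr_eq0 -lt0n.
  by rewrite -exprD subnK // -ltnS prednK.
have [[A B] /= [nA nB] AB] := @filterI _ _ FF _ _ near1 near2.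
exists (A `&` B); first exact: filterI.
move=> e1 e2 s [A1 _] [_ B2] es i.
have [/= d1 d2] := AB (e1, e2) (conj A1 B2).
have sE j : s j = j.
  apply/eqP/negPn/negP => sj; have := d1 (j, s j); rewrite eq_sym.
  by move=> /(_ sj); rewrite /= es subrr eqxx.
apply/esym/eqP; rewrite -subr_eq0.
have := subrXX (c e2 i) (c e1 i) m; rewrite es sE subrr.
move=> /esym/eqP; rewrite mulf_eq0 => /orP[//|].
by have := d2 i; rewrite /S /= => /negbTE ->.
Qed.

End ComplexContinuity.

(** * The covering of the orbit space by squaring *)

Section PowerCover.
Variables (R : realType) (r n : nat).
Local Notation C := (complexes R).
Local Open Scope quotient_scope.

Lemma monomial_complementP k (z : 'cV[C]_n) :
  @monomial_complement R k n z <->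
  (forall i, z i ord0 != 0) /\
  (forall i j, z i ord0 ^+ k = z j ord0 ^+ k -> i = j).
Proof.
rewrite /monomial_complement /= mulf_eq0 negb_or; split.
  move=> /andP[/prodf_neq0 z0 /prodf_neq0 zd]; split=> [i|]; first exact: z0.
  suff lt_inj (i j : 'I_n) : (i < j)%N -> z i ord0 ^+ k <> z j ord0 ^+ k.
    move=> i j ij; case: (ltngtP i j) => [/lt_inj //|/lt_inj e|/val_inj //].
    by case: e.
  move=> ij e; have /prodf_neq0/(_ j ij) := zd i isT.
  by rewrite e subrr eqxx.
move=> [z0 zd]; apply/andP; split; apply/prodf_neq0 => i _ //.
apply/prodf_neq0 => j ij; rewrite subr_eq0; apply/eqP => /zd e.
by rewrite e ltnn in ij.
Qed.

Lemma monomial_complement_perm k l (z w : 'cV[C]_n) (s : {perm 'I_n}) :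
  (0 < k)%N -> (0 < l)%N ->
  (forall i, w i ord0 ^+ k = z (s i) ord0 ^+ l) ->
  @monomial_complement R l n z -> @monomial_complement R k n w.
Proof.
move=> k0 l0 wz /monomial_complementP[z0 zd].
apply/monomial_complementP; split=> [i|i j]; last first.
  by rewrite !wz => /zd; exact: perm_inj.
have : w i ord0 ^+ k != 0 by rewrite wz expf_neq0.
by rewrite expf_eq0 k0.
Qed.

Definition configuration k : topologicalType :=
  set_type (@monomial_complement R k n).

Definition config k z (Mz : @monomial_complement R k n z) : configuration k :=
  exist (fun z => z \in @monomial_complement R k n) z (mem_set Mz).

Definition coord k (e : configuration k) (i : 'I_n) : C := set_val e i ord0.

Lemma configP k (e : configuration k) : @monomial_complement R k n (set_val e).
Proof. by case: e => z Mz; exact: set_mem Mz. Qed.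

Lemma coord_neq0 k (e : configuration k) i : coord e i != 0.
Proof. by have /monomial_complementP[e0 _] := configP e; exact: e0. Qed.

Lemma coordX_inj k (e : configuration k) i j :
  coord e i ^+ k = coord e j ^+ k -> i = j.
Proof. by have /monomial_complementP[_ einj] := configP e; exact: einj. Qed.

Lemma configuration_eq k (e e' : configuration k) :
  (forall i, coord e i = coord e' i) -> e = e'.
Proof.
move=> ee'; apply: val_inj; apply/matrixP => i j.
by rewrite (ord1 j); exact: ee'.
Qed.

Lemma set_val_continuous k :
  continuous (set_val : configuration k -> 'cV[C]_n).
Proof. exact: (@initial_continuous _ _ set_val). Qed.

Lemma coord_config_continuous k i : continuous (fun e : configuration k => coord e i).
Proof.
exact: (comp_continuous (@set_val_continuous k) (@coord_continuous _ _ _ i ord0)).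
Qed.

Lemma configuration_continuous (T : topologicalType) k (f : T -> configuration k) :
  (forall i, continuous (fun t => coord (f t) i)) -> continuous f.
Proof.
move=> cf; apply/continuous_comp_initial; apply: mx_continuous => i j.
by rewrite (ord1 j); exact: cf.
Qed.

Lemma configuration_hausdorff k : hausdorff_space (configuration k).
Proof.
rewrite open_hausdorff => e e' ee'.
have ee'v : set_val e != set_val e' by apply: contra_neq ee' => /val_inj.
have := @norm_hausdorff _ ('cV[C]_n : pseudoMetricNormedZmodType C).
rewrite open_hausdorff => /(_ _ _ ee'v)[[A B] /= [/set_mem eA /set_mem eB]].
move=> [oA oB /eqP AB].
have /continuousP cv := @set_val_continuous k.
exists (set_val @^-1` A, set_val @^-1` B) => /=; first by split; apply/mem_set.
split; [exact: cv|exact: cv|].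
by rewrite -preimage_setI AB preimage_set0.
Qed.

Definition orbit (z : configuration r) : monomial_orbit_space R r n :=
  \pi_({eq_quot (@same_orbit_equiv R r n)}) z.

Lemma orbit_surj x : exists z, orbit z = x.
Proof. by exists (repr (x : {eq_quot (@same_orbit_equiv R r n)})); exact: reprK. Qed.

Lemma orbit_continuous : continuous orbit.
Proof. exact: pi_continuous. Qed.

Lemma open_orbit_preimage (A : set (monomial_orbit_space R r n)) :
  open (orbit @^-1` A) -> open A.
Proof. by []. Qed.

Hypothesis r_gt0 : (0 < r)%N.

(** The orbit of a configuration is the unordered tuple of the [r]-th powers of
    its coordinates: quotients of coordinates with equal [r]-th powers are the
    entries of a monomial matrix. *)
Lemma orbitP (z w : configuration r) :
  orbit z = orbit w <->
  exists s : {perm 'I_n}, forall i, coord w i ^+ r = coord z (s i) ^+ r.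
Proof.
split=> [/eqmodP/asboolP[g [g1 g2 g3] wE]|[s ws]].
  pose s i := xget i [set j | g i j != 0].
  have gs i : g i (s i) != 0.
    by have [j [gij _]] := g1 i; rewrite /s; case: xgetP => [k -> //|/(_ j)].
  have su i j : g i j != 0 -> j = s i.
    by move=> gij; have [k [_ ku]] := g1 i; rewrite -(ku j gij) (ku _ (gs i)).
  have s_inj : injective s.
    move=> i j sij; have [k [_ ku]] := g2 (s i).
    by rewrite -(ku i (gs i)); apply: ku; rewrite sij; exact: gs.
  exists (perm s_inj) => i; rewrite permE /coord wE mxE (bigD1 (s i)) //=.
  rewrite big1 ?addr0 => [|j js]; last first.
    have [->|/su e] := eqVneq (g i j) 0; first by rewrite mul0r.
    by rewrite e eqxx in js.
  by rewrite exprMn (g3 _ _ (gs i)) mul1r.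
apply/eqmodP/asboolP.
pose g : 'M[C]_n := \matrix_(i, j) (if j == s i then coord w i / coord z j else 0).
have gE i j : (g i j != 0) = (j == s i).
  rewrite mxE; case: (j =P s i) => _; last by rewrite eqxx.
  by rewrite mulf_neq0 ?invr_neq0 ?coord_neq0.
exists g.
  split=> [i|j|i j].
  - by exists (s i); split=> [|j]; rewrite gE // => /eqP.
  - exists ((s^-1)%g j); split=> [|i]; rewrite gE; first by rewrite permKV.
    by move=> /eqP ->; rewrite permK.
  - rewrite gE => /eqP ->; rewrite mxE eqxx expr_div_n ws divff //.
    by rewrite expf_neq0 ?coord_neq0.
apply/matrixP => i j; rewrite (ord1 j) mxE (bigD1 (s i)) //= big1 ?addr0.
  by rewrite mxE eqxx mulfVK ?coord_neq0.
by move=> k ks; rewrite mxE (negbTE ks) mul0r.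
Qed.

Local Notation m := (2 * r)%N.

Lemma m_gt0 : (0 < m)%N.
Proof. by rewrite muln_gt0. Qed.

Lemma square_subproof (e : configuration m) :
  @monomial_complement R r n (\col_i coord e i ^+ 2).
Proof.
apply: (@monomial_complement_perm r m (set_val e) _ 1%g) => //.
- exact: m_gt0.
- by move=> i; rewrite mxE perm1 -exprM.
- exact: configP e.
Qed.

Definition square (e : configuration m) : configuration r :=
  config (square_subproof e).

Lemma coord_square e i : coord (square e) i = coord e i ^+ 2.
Proof. by rewrite /coord /= mxE. Qed.

(** The doubled exponent makes the deck group [G(2r,1,n)] non-abelian for all
    [r >= 1] and [n >= 2], whereas [G(1,1,2)] is abelian. *)
Definition cover (e : configuration m) : monomial_orbit_space R r n :=
  orbit (square e).

Lemma cover_orbitP (e : configuration m) (z : configuration r) :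
  cover e = orbit z <->
  exists s : {perm 'I_n}, forall i, coord z i ^+ r = coord e (s i) ^+ m.
Proof.
rewrite /cover orbitP; split=> -[s zs]; exists s => i;
  by rewrite zs coord_square exprM.
Qed.

Lemma coverP (e e' : configuration m) :
  cover e = cover e' <->
  exists s : {perm 'I_n}, forall i, coord e' i ^+ m = coord e (s i) ^+ m.
Proof.
rewrite cover_orbitP; split=> -[s zs]; exists s => i.
  by rewrite -zs coord_square exprM.
by rewrite -zs coord_square exprM.
Qed.

Lemma cover_continuous : continuous cover.
Proof.
apply: (comp_continuous _ orbit_continuous).
apply: configuration_continuous => i; under eq_fun do rewrite coord_square.
exact/continuousX_complex/coord_config_continuous.
Qed.

Lemma config_root (z : configuration r) (c : 'I_n -> C) (s : {perm 'I_n}) :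
  (forall i, c i ^+ m = coord z i ^+ r) ->
  exists2 e : configuration m, cover e = orbit z & forall i, coord e (s i) = c i.
Proof.
move=> cz; have M : @monomial_complement R m n (\col_i c ((s^-1)%g i)).
  apply: (@monomial_complement_perm m r (set_val z) _ (s^-1)%g) => //.
  - exact: m_gt0.
  - by move=> i; rewrite mxE cz.
  - exact: configP z.
have eE i : coord (config M) (s i) = c i by rewrite /coord /= mxE permK.
exists (config M) => //; apply/cover_orbitP; exists s => i.
by rewrite eE cz.
Qed.

Lemma cover_surj x : exists e, cover e = x.
Proof.
have [z <-] := orbit_surj x.
have [|e ez _] := @config_root z (fun i => sqrtC (coord z i)) 1%g.
  by move=> i; rewrite exprM sqrtCK.
by exists e.
Qed.

(** Points close to [cover e] are lifted close to [e] by choosing [2r]-th roots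
    close to the coordinates of [e]. *)
Lemma cover_open (e : configuration m) (U : set (configuration m)) :
  nbhs e U -> nbhs (cover e) (cover @` U).
Proof.
rewrite nbhsE => -[W [oW We] WU].
suff oV : open (cover @` W).
  suff : nbhs (cover e) (cover @` W) by apply: filterS; exact: image_subset.
  apply: open_nbhs_nbhs.
  by split=> //; exists e.
apply: open_orbit_preimage; rewrite openE => z [{}e {}We].
move=> /cover_orbitP[s zs]; rewrite /interior.
have [A oA AW] := oW; have Ae : nbhs (set_val e) A.
  by apply: open_nbhs_nbhs; split=> //; move: We; rewrite -AW.
have [P nP PA] := Ae.
have near_i i : \forall z' \near z, exists2 c, P (s i) ord0 c & c ^+ m = coord z' i ^+ r.
  have := near_root m_gt0 (nP (s i) ord0); rewrite -[X in X ^+ m]/(coord e (s i)) -zs => h.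
  exact: (@continuousX_complex R _ _ r (@coord_config_continuous r i) z _ h).
have near_c := filter_forall (nbhs_filter z) near_i.
apply: (@filterS _ _ (nbhs_filter z) _ _ _ near_c) => z' cz'.
have /choice[c cP] : forall i, exists c, P (s i) ord0 c /\ c ^+ m = coord z' i ^+ r.
  by move=> i; have [c ? ?] := cz' i; exists c.
have [|e' e'z' e'c] := @config_root z' c s; first by move=> i; exact: (cP i).2.
exists e' => //; rewrite -AW; apply: PA => i j.
rewrite (ord1 j) -(permKV s i) -/(coord e' (s ((s^-1)%g i))) e'c.
exact: (cP _).1.
Qed.

Lemma cover_locally_injective (e : configuration m) :
  exists2 U, nbhs e U &
    forall e1 e2, U e1 -> U e2 -> cover e1 = cover e2 -> e1 = e2.
Proof.
have [//|i|i j|U nU injU] :=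
  @power_locally_injective R n m _ (fun x i => coord x i) e m_gt0.
- exact: coord_config_continuous.
- exact: coord_neq0.
- exact: coordX_inj.
exists U => // e1 e2 U1 U2 /coverP[s es]; apply: configuration_eq.
exact: injU U1 U2 es.
Qed.

(** The quotients of corresponding coordinates are [2r]-th roots of unity. *)
Lemma deck_transformation (e e' : configuration m) (s : {perm 'I_n}) :
  (forall i, coord e' i ^+ m = coord e (s i) ^+ m) ->
  exists d : configuration m -> configuration m,
    [/\ continuous d, forall x, cover (d x) = cover x
      & forall x i, coord (d x) i = coord e' i / coord e (s i) * coord x (s i)].
Proof.
move=> es; pose c i := coord e' i / coord e (s i).
have cm i : c i ^+ m = 1.
  by rewrite expr_div_n es divff // expf_neq0 ?coord_neq0.
have M (x : configuration m) :
    @monomial_complement R m n (\col_i (c i * coord x (s i))).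
  apply: (@monomial_complement_perm m m (set_val x) _ s); try exact: m_gt0.
    by move=> i; rewrite mxE exprMn cm mul1r.
  exact: configP x.
have dE x i : coord (config (M x)) i = c i * coord x (s i).
  by rewrite /coord /= mxE.
exists (fun x => config (M x)); split=> //.
- apply: configuration_continuous => i; under eq_fun do rewrite dE.
  apply: continuousM_complex; first exact: cst_continuous.
  exact: coord_config_continuous.
- move=> x; apply/esym/coverP; exists s => i.
  by rewrite dE exprMn cm mul1r.
Qed.

Lemma cover_deck (e e' : configuration m) : cover e = cover e' ->
  exists d : configuration m -> configuration m,
    [/\ continuous d, d e = e' & forall x, cover (d x) = cover x].
Proof.
move=> /coverP[s es]; have [d [cd pd dE]] := deck_transformation es.
exists d; split=> //; apply: configuration_eq => i.
by rewrite dE mulfVK ?coord_neq0.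
Qed.

Lemma cover_covering : covering cover.
Proof.
exact: covering_of_deck cover_surj cover_open cover_locally_injective cover_deck.
Qed.

End PowerCover.

(** * Squares of paths and change of base point *)

Section Paths.
Variables (R : realType) (X : topologicalType).
Local Notation I := (unit_interval R).

Lemma concat_path_lift (Y : topologicalType) (c : Y -> X) (y1 y2 y3 : Y)
    (x1 x2 x3 : X) (p : {path I from y1 to y2}) (q : {path I from y2 to y3})
    (P : {path I from x1 to x2}) (Q : {path I from x2 to x3}) :
  (forall t, c (p t) = P t) -> (forall t, c (q t) = Q t) ->
  forall t, c (concat_path p q t) = concat_path P Q t.
Proof.
move=> pP qQ t; rewrite !concat_pathE /concat_fun /extend_path.
by case: ifP => _; rewrite ?pP ?qQ.
Qed.

(** The two products are read along the two ways from a corner of the square to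
    the opposite one, and straight lines in the square join these ways. *)
Lemma square_commute (x : X) (a b : {path I from x to x}) (K : I * I -> X) :
  continuous K -> (forall s, K (s, zero) = a s /\ K (s, one) = a s) ->
  (forall t, K (zero, t) = b t /\ K (one, t) = b t) ->
  path_homotopic (concat_path a b) (concat_path b a).
Proof.
move=> cK Ka Kb.
(* (c1, c2) runs along the bottom and right edges, (c2, c1) along the left and
   top edges *)
pose c1 (u : I) : R := unit_interval_val (clamp (2 * unit_interval_val u + 0)).
pose c2 (u : I) : R := unit_interval_val (clamp (2 * unit_interval_val u + (- 1))).
have cc (k : R) : continuous
    (fun u : I => unit_interval_val (clamp (2 * unit_interval_val u + k))).
  apply: comp_continuous (@unit_interval_val_continuous R).
  apply: comp_continuous (@clamp_continuous R).
  exact: affine_continuous (@unit_interval_val_continuous R).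
pose H (st : I * I) := let t := unit_interval_val st.2 in
  K (clamp ((1 - t) * c1 st.1 + t * c2 st.1),
     clamp ((1 - t) * c2 st.1 + t * c1 st.1)).
have cmix (f g : I -> R) : continuous f -> continuous g ->
    continuous (fun st : I * I => clamp ((1 - unit_interval_val st.2) * f st.1 +
                                        unit_interval_val st.2 * g st.1)).
  move=> cf cg; apply: comp_continuous (@clamp_continuous R) => st.
  have cv := @unit_interval_snd_continuous R.
  apply: cvgD; apply: cvgM.
  - by apply: cvgB; [exact: cvg_cst|exact: cv].
  - exact: (comp_continuous (@fst_continuous _ _) cf).
  - exact: cv.
  - exact: (comp_continuous (@fst_continuous _ _) cg).
have c10 u : unit_interval_val u <= 2^-1 -> clamp (c2 u) = zero.
  by move=> u2; rewrite /c2 clampK clamp_le0 //; lra.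
have c21 u : 2^-1 < unit_interval_val u -> clamp (c1 u) = one.
  by move=> u2; rewrite /c1 clampK clamp_ge1 //; lra.
exists H; split.
- by apply: comp_continuous cK; apply: pair_continuous; apply: cmix; exact: cc.
- move=> u; rewrite /H /= unit_interval_val0 unit_interval_val1 subr0 subrr.
  rewrite !mul1r !mul0r !add0r !addr0 !concat_pathE /concat_fun /extend_path.
  case: leP => u2; first by rewrite c10 // /c1 clampK (Ka _).1 (Kb _).1.
  by rewrite c21 // /c2 clampK (Kb _).2 (Ka _).2.
- have xx : K (zero, zero) = x by rewrite (Ka _).1 path_zero.
  have yy : K (one, one) = x by rewrite (Ka _).2 path_one.
  move=> t; rewrite /H /= /c1 /c2 unit_interval_val0 unit_interval_val1.
  have cl0 : clamp (2 * 0 + 0 : R) = zero by rewrite mulr0 addr0.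
  have cl0' : clamp (2 * 0 + (- 1) : R) = zero by rewrite clamp_le0 //; lra.
  have cl1 : clamp (2 * 1 + 0 : R) = one by rewrite clamp_ge1 //; lra.
  have cl1' : clamp (2 * 1 + (- 1) : R) = one by rewrite clamp_ge1 //; lra.
  rewrite cl0 cl0' cl1 cl1' -!mulrDl subrK !mul1r !clampK.
  by split.
Qed.

Section ChangeOfBase.
Variables (x y : X) (c : {path I from x to y}).
Local Open Scope group_scope.

Definition transport_loop (x' y' : X) (c : {path I from x' to y'})
    (p : {path I from y' to y'}) : {path I from x' to x'} :=
  concat_path c (concat_path p (reverse_path c)).

Definition change_base (a : fundamental_group R y) : fundamental_group R x :=
  loop_class (transport_loop c (loop_repr a)).

Lemma transport_homotopic (p q : {path I from y to y}) :
  path_homotopic p q -> path_homotopic (transport_loop c p) (transport_loop c q).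
Proof.
move=> pq; apply: concat_path_homotopic; first exact: path_homotopic_refl.
by apply: concat_path_homotopic => //; exact: path_homotopic_refl.
Qed.

Lemma change_baseE (p : loop R y) :
  change_base (loop_class p) = loop_class (transport_loop c p).
Proof.
by apply/loop_classP/transport_homotopic/loop_classP; exact: loop_reprK.
Qed.

Lemma concat_cancel (z : X) (q : {path I from y to z}) :
  path_homotopic (concat_path (reverse_path c) (concat_path c q)) q.
Proof.
apply: path_homotopic_trans (concat_pathA _ _ _) _.
apply: path_homotopic_trans (concat_1path q).
by apply: concat_path_homotopic; [exact: concat_Vpath|exact: path_homotopic_refl].
Qed.

Lemma change_baseM : {morph change_base : a b / a * b}.
Proof.
move=> a b; rewrite -(loop_reprK a) -(loop_reprK b) [LHS](congr1 _ (pi1_mulE _ _)).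
rewrite !change_baseE [RHS]pi1_mulE; apply/loop_classP.
move: (loop_repr a) (loop_repr b) => p q; rewrite /transport_loop.
apply: path_homotopic_sym.
apply: path_homotopic_trans (path_homotopic_sym (concat_pathA _ _ _)) _.
apply: concat_path_homotopic; first exact: path_homotopic_refl.
apply: path_homotopic_trans (path_homotopic_sym (concat_pathA _ _ _)) _.
apply: path_homotopic_trans (concat_pathA _ _ _).
apply: concat_path_homotopic; first exact: path_homotopic_refl.
exact: concat_cancel.
Qed.

Lemma change_base_inj : injective change_base.
Proof.
move=> a b; rewrite -(loop_reprK a) -(loop_reprK b) !change_baseE.
move: (loop_repr a) (loop_repr b) => p q /loop_classP pq; apply/loop_classP.
have cancel (u : {path I from y to y}) : path_homotopic
    (concat_path (concat_path (reverse_path c) (transport_loop c u)) c) u.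
  have h : path_homotopic (concat_path (reverse_path c) (transport_loop c u))
      (concat_path u (reverse_path c)) by exact: concat_cancel.
  apply: path_homotopic_trans (concat_path_homotopic h (path_homotopic_refl c)) _.
  apply: path_homotopic_trans (path_homotopic_sym (concat_pathA _ _ _)) _.
  apply: path_homotopic_trans (concat_path1 u).
  by apply: concat_path_homotopic; [exact: path_homotopic_refl|exact: concat_Vpath].
apply: path_homotopic_trans (path_homotopic_sym (cancel p)) _.
apply: path_homotopic_trans (cancel q).
apply: concat_path_homotopic; last exact: path_homotopic_refl.
by apply: concat_path_homotopic => //; exact: path_homotopic_refl.
Qed.

End ChangeOfBase.
End Paths.

(** * Path connectedness of the complement *)

Section Connectivity.
Variables (R : realType) (n : nat).
Local Notation C := (complexes R).
Local Notation I := (unit_interval R).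

Lemma complex_continuous (T : topologicalType) (f g : T -> R) :
  continuous f -> continuous g -> continuous (fun t => (f t +i* g t)%C : C).
Proof.
move=> cf cg; under eq_fun do rewrite [(_ +i* _)%C]complexE /=.
have cfC := comp_continuous cf (@real_complex_continuous R).
have cgC := comp_continuous cg (@real_complex_continuous R).
move=> t; apply: cvgD; first exact: cfC.
by apply: cvgM; [exact: cvg_cst|exact: cgC].
Qed.

Lemma complex_affine_continuous (T : topologicalType) (f : T -> C) (a b : C) :
  continuous f -> continuous (fun t => a + b * f t).
Proof.
move=> cf t; apply: cvgD; first exact: cvg_cst.
by apply: cvgM; [exact: cvg_cst|exact: cf].
Qed.

Lemma exists_notin (s : seq R) : exists x, x \notin s.
Proof.
pose b := \sum_(x <- s) `|x|; exists (1 + b); apply/negP => bs.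
have b0 : 0 <= b by exact: sumr_ge0.
have : `|1 + b| <= b.
  rewrite {2}/b (big_rem _ bs) /= lerDl; exact: sumr_ge0.
by rewrite ger0_norm ?addr_ge0 //; lra.
Qed.

(** The arcs [t + c * t * (1 - t) *i] from [0] to [1] are pairwise disjoint away
    from their ends, so some arc avoids a given finite set. *)
Lemma arc_avoids (P : {poly C}) : P.[0] != 0 -> P.[1] != 0 ->
  exists c : R, forall t : R, P.[(t +i* (c * t * (1 - t)))%C] != 0.
Proof.
move=> P0 P1; have Pn0 : P != 0 by apply: contraNneq P0 => ->; rewrite horner0.
have [rs PE] := closed_field_poly_normal P.
have rootE u : (P.[u] == 0) = (u \in rs).
  rewrite -[P.[u] == 0]/(root P u) PE rootZ ?lead_coef_eq0 //.
  by rewrite root_prod_XsubC.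
pose slope (a : C) : R := complex.Im a / (complex.Re a * (1 - complex.Re a)).
have [c cs] := exists_notin [seq slope a | a <- rs].
exists c => t; rewrite rootE; apply: contra cs => trs.
apply/mapP; exists (t +i* (c * t * (1 - t)))%C => //.
have t0 : t != 0.
  by apply: contraNneq P0 => t0; move: trs; rewrite t0 mulr0 mul0r -rootE.
have t1 : 1 - t != 0.
  apply: contraNneq P1 => /eqP; rewrite subr_eq0 => /eqP t1; move: trs.
  by rewrite -t1 subrr mulr0 -rootE.
by rewrite /slope /= -mulrA mulfK // mulf_neq0.
Qed.

(** On the complex line through [z] and [w] the equation of the arrangement is a
    polynomial [P], nonzero at both points. *)
Lemma configuration_path_connected k (z w : configuration R n k) :
  inhabited {path I from z to w}.
Proof.
pose l i : {poly C} := (coord z i)%:P + (coord w i - coord z i)%:P * 'X.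
pose P := (\prod_i l i) * \prod_(i < n) \prod_(j < n | (i < j)%N) (l i ^+ k - l j ^+ k).
pose pt (u : C) : 'cV[C]_n := \col_i (l i).[u].
have PE u : @monomial_complement R k n (pt u) = (P.[u] != 0) :> Prop.
  rewrite /monomial_complement /= /P hornerM !horner_prod.
  congr (_ * _ != 0); first by apply: eq_bigr => i _; rewrite mxE.
  apply: eq_bigr => i _; rewrite horner_prod; apply: eq_bigr => j _.
  by rewrite hornerD hornerN !horner_exp !mxE.
have pt0 : pt 0 = set_val z.
  by apply/matrixP => i j; rewrite (ord1 j) mxE hornerD hornerM !hornerC hornerX
    ?mulr0 ?addr0.
have pt1 : pt 1 = set_val w.
  by apply/matrixP => i j; rewrite (ord1 j) mxE hornerD hornerM !hornerC hornerX
    mulr1 addrC subrK.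
have P0 : P.[0] != 0 by have := configP z; rewrite -pt0 PE.
have P1 : P.[1] != 0 by have := configP w; rewrite -pt1 PE.
have [c Pc] := arc_avoids P0 P1.
pose u (t : I) : C := let x := unit_interval_val t in (x +i* (c * x * (1 - x)))%C.
have Mu t : @monomial_complement R k n (pt (u t)) by rewrite PE; exact: Pc.
pose f t : configuration R n k := config (Mu t).
have cu : continuous u.
  have cid : continuous (fun x : R => x) by move=> x; exact: cvg_id.
  have carc : continuous (fun x : R => (x +i* (c * x * (1 - x)))%C : C).
    apply: complex_continuous => //= x; apply: cvgM.
      by apply: cvgM; [exact: cvg_cst|exact: cid].
    by apply: cvgB; [exact: cvg_cst|exact: cid].
  exact: comp_continuous (@unit_interval_val_continuous R) carc.
have cf : continuous f.
  apply: configuration_continuous => i.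
  have -> : (fun t => coord (f t) i) =
      (fun t => coord z i + (coord w i - coord z i) * u t).
    by apply/funext => t; rewrite {1}/coord /= mxE hornerD hornerM !hornerC hornerX
    ?mulr0 ?addr0.
  exact: complex_affine_continuous.
have f0 : f zero = z.
  apply: val_inj; rewrite -[RHS]pt0 /=; congr (pt _).
  by rewrite /u /= unit_interval_val0 mulr0 mul0r.
have f1 : f one = w.
  apply: val_inj; rewrite -[RHS]pt1 /=; congr (pt _).
  by rewrite /u /= unit_interval_val1 subrr mulr0.
by constructor; exact: mk_path cf f0 f1.
Qed.

End Connectivity.

(** * Rotation of configurations *)

Section Rotation.
Variable R : realType.
Local Notation C := (complexes R).

Definition expi (a : R) : C := (cos a +i* sin a)%C.

Lemma expiD a b : expi (a + b) = expi a * expi b.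
Proof. by rewrite /expi cosD sinD [sin a * cos b + _]addrC. Qed.

Lemma expi0 : expi 0 = 1.
Proof. by rewrite /expi cos0 sin0. Qed.

Lemma expi2pi : expi (pi *+ 2) = 1.
Proof. by rewrite /expi cos2pi sin2pi. Qed.

Lemma expi_neq0 a : expi a != 0.
Proof.
apply/eqP => a0; have := expi0; rewrite -(subrr a) expiD a0 mul0r => /eqP.
by rewrite eq_sym oner_eq0.
Qed.

Lemma expiX a k : expi a ^+ k = expi (a *+ k).
Proof. by elim: k => [|k IH]; rewrite ?mulr0n ?expi0 // exprS IH -expiD mulrS. Qed.

Lemma expi_neq1 a : 0 < a < pi *+ 2 -> expi a != 1.
Proof.
move=> a02; have aE : a = (a / 2) *+ 2 by rewrite -mulr_natr divfK.
have s0 : 0 < sin (a / 2) by apply: sin_gt0_pi; move: a02; rewrite mulr2n; lra.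
apply/eqP => -[]; rewrite {1}aE cos_mulr2n cos2sin2 => ca _.
have : 0 < sin (a / 2) ^+ 2 by rewrite exprn_gt0.
by move: ca; rewrite mulr2n; lra.
Qed.

Lemma expi_continuous : continuous expi.
Proof. by apply: complex_continuous; [exact: continuous_cos|exact: continuous_sin]. Qed.

End Rotation.

Section RotationLoops.
Variables (R : realType) (r n : nat).
Local Notation C := (complexes R).
Local Notation I := (unit_interval R).
Local Notation m := (2 * r)%N.
Local Notation E := (configuration R n m).
Hypothesis r_gt0 : (0 < r)%N.

Lemma scale_subproof (c : 'I_n -> C) (e : E) (d : C) :
  d != 0 -> (forall i, c i ^+ m = d) ->
  @monomial_complement R m n (\col_i (c i * coord e i)).
Proof.
move=> d0 cd; apply/monomial_complementP; split=> [i|i j].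
  rewrite mxE mulf_neq0 ?coord_neq0 //; apply: contra_neq d0 => ci.
  by rewrite -(cd i) ci expr0n muln_eq0 /= -leqn0 leqNgt r_gt0.
by rewrite !mxE !exprMn !cd => /(mulfI d0)/coordX_inj.
Qed.

Definition rotate (a : R) (e : E) : E :=
  config (scale_subproof e (expf_neq0 m (expi_neq0 a)) (fun=> erefl)).

Lemma coord_rotate a e i : coord (rotate a e) i = expi a * coord e i.
Proof. by rewrite /coord /= mxE. Qed.

Lemma rotateD a b e : rotate (a + b) e = rotate a (rotate b e).
Proof. by apply: configuration_eq => i; rewrite !coord_rotate expiD mulrA. Qed.

Lemma rotate0 e : rotate 0 e = e.
Proof. by apply: configuration_eq => i; rewrite coord_rotate expi0 mul1r. Qed.

Lemma rotate_continuous (T : topologicalType) (a : T -> R) (f : T -> E) :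
  continuous a -> continuous f -> continuous (fun t => rotate (a t) (f t)).
Proof.
move=> ca cf; apply: configuration_continuous => i.
under eq_fun do rewrite coord_rotate.
apply: continuousM_complex; first exact: comp_continuous ca (@expi_continuous R).
exact: comp_continuous cf (@coord_config_continuous _ _ _ _).
Qed.

Local Notation p := (@cover R r n r_gt0).

Lemma cover_rotate a e e' : p e = p e' -> p (rotate a e) = p (rotate a e').
Proof.
move=> /coverP[s es]; apply/coverP; exists s => i.
by rewrite !coord_rotate !exprMn es.
Qed.

(** A turn by [pi / r] multiplies [2r]-th powers by [exp(2 pi i) = 1]. *)
Lemma cover_full_turn e : p (rotate (pi / r%:R) e) = p e.
Proof.
apply/esym/coverP; exists 1%g => i; rewrite perm1 coord_rotate exprMn expiX.
rewrite (_ : (_ / _) *+ m = pi *+ 2) ?expi2pi ?mul1r //.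
by rewrite mulnC mulrnA -[_ *+ r]mulr_natr divfK // pnatr_eq0 -lt0n.
Qed.

Section RotationPath.
Variables (a : R) (e : E).

Definition rotation_fun (t : I) : E := rotate (a * unit_interval_val t + 0) e.

Lemma rotation_fun_continuous : continuous rotation_fun.
Proof.
apply: rotate_continuous; last exact: cst_continuous.
exact: affine_continuous (@unit_interval_val_continuous R).
Qed.

Lemma rotation_fun0 : rotation_fun zero = e.
Proof. by rewrite /rotation_fun unit_interval_val0 mulr0 addr0 rotate0. Qed.

Lemma rotation_fun1 : rotation_fun one = rotate a e.
Proof. by rewrite /rotation_fun unit_interval_val1 mulr1 addr0. Qed.

Definition rotation_path : {path I from e to rotate a e} :=
  mk_path rotation_fun_continuous rotation_fun0 rotation_fun1.

Lemma rotation_pathE t : rotation_path t = rotate (a * unit_interval_val t) e.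
Proof. by rewrite -[LHS]/(rotation_fun t) /rotation_fun addr0. Qed.

End RotationPath.

Section CoverPath.
Variables (e e' : E) (x y : monomial_orbit_space R r n).
Variables (f : {path I from e to e'}) (ex : p e = x) (e'y : p e' = y).

Lemma cover_path_continuous : continuous (fun t : I => p (f t)).
Proof.
exact: comp_continuous (@cts_fun _ _ f) (@cover_continuous R r n r_gt0).
Qed.

Lemma cover_path0 : p (f zero) = x.
Proof. by rewrite path_zero. Qed.

Lemma cover_path1 : p (f one) = y.
Proof. by rewrite path_one. Qed.

Definition cover_path : {path I from x to y} :=
  mk_path cover_path_continuous cover_path0 cover_path1.

End CoverPath.

Section RotationPower.
Variables (a : R) (e : E) (ea : p (rotate a e) = p e).

Lemma cover_rotate_nat k : p (rotate (k%:R * a) e) = p e.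
Proof.
elim: k => [|k IH]; first by rewrite mul0r rotate0.
by rewrite mulrS mulrDl mul1r rotateD (cover_rotate _ IH).
Qed.

Definition rotation_loop k : loop R (p e) :=
  cover_path (rotation_path (k%:R * a) e) erefl (cover_rotate_nat k).

Lemma rotation_loopE k t :
  rotation_loop k t = p (rotate (k%:R * a * unit_interval_val t) e).
Proof. by rewrite -[LHS]/(p (rotation_path _ _ t)) rotation_pathE. Qed.

Lemma extend_rotation_loop k t : 0 <= t <= 1 ->
  extend_path (rotation_loop k) t = p (rotate (k%:R * a * t) e).
Proof. by move=> t01; rewrite /extend_path rotation_loopE val_clamp. Qed.

(** A turn by [k * a] starting at [rotate a e] has the same image as one
    starting at [e], so the loops of angles [a] and [k * a] follow each other
    like two parts of one rotation. *)
Lemma rotation_loop_exp k :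
  (loop_class (rotation_loop 1) ^+ k)%g = loop_class (rotation_loop k).
Proof.
elim: k => [|k IH].
  rewrite -[LHS]/(loop_class (constant_path R (p e))).
  congr loop_class; apply/path_eqP => t.
  by rewrite rotation_loopE !mul0r rotate0.
rewrite expgS IH [LHS]pi1_mulE; apply/loop_classP.
have k1 : (k.+1%:R : R) != 0 by rewrite pnatr_eq0.
have k0 : 0 <= k%:R :> R := ler0n R k.
have kS : k.+1%:R = 1 + k%:R :> R by rewrite mulrS.
(* the concatenation turns by [a] on the first half and by [k * a] on the
   second: [v] is that angle divided by [k.+1 * a] *)
pose v (t : R) := k.+1%:R^-1 *
  (if t <= 2^-1 then 2 * t + 0 else (k%:R * 2) * t + (1 - k%:R)).
have cv : continuous v.
  have cid : continuous (fun t : R => t) by move=> t; exact: cvg_id.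
  have cif : continuous (fun t : R =>
      if t <= 2^-1 then 2 * t + 0 else (k%:R * 2) * t + (1 - k%:R)).
    apply: continuous_if_le => //; try exact: affine_continuous.
    by move=> t ->; rewrite -mulrA divff ?pnatr_eq0 //; lra.
  by move=> t; apply: cvgM; [exact: cvg_cst|exact: cif].
have v0 : v 0 = 0.
  by rewrite /v ifT ?invr_ge0 ?ler0n // mulr0 addr0 mulr0.
have v1 : v 1 = 1.
  rewrite /v ifF; last by apply/negbTE; rewrite -ltNge; lra.
  have -> : k%:R * 2 * 1 + (1 - k%:R) = k.+1%:R :> R by rewrite kS; lra.
  by rewrite mulVf.
apply: (@reparametrization_homotopic _ _ _ _ _ _ (rotation_loop k.+1) _ _ v id) => //.
- by move=> t; exact: cvg_id.
- move=> s; rewrite concat_pathE /concat_fun.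
  have /andP[s0 s1] := unit_interval_bounds s.
  move: (unit_interval_val s) s0 s1 => t t0 t1.
  have k_inv : 0 < k.+1%:R^-1 :> R by rewrite invr_gt0 ltr0n.
  have vk : k.+1%:R * a * v t = a * (k.+1%:R * v t) by rewrite mulrAC mulrC.
  have kv : k.+1%:R * v t =
      if t <= 2^-1 then 2 * t + 0 else (k%:R * 2) * t + (1 - k%:R).
    by rewrite /v mulVKf.
  have v01 : 0 <= v t <= 1.
    have kv01 : 0 <= k.+1%:R * v t <= k.+1%:R * 1.
      rewrite mulr1 kv kS; case: (leP t 2^-1) => t2; first by lra.
      apply/andP; split; nra.
    case/andP: kv01 => kv0 kv1.
    by rewrite -(pmulr_rge0 _ (ltr0Sn R k)) kv0 -(ler_pM2l (ltr0Sn R k)).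
  rewrite (extend_rotation_loop _ v01) vk kv; case: (leP t 2^-1) => t2.
    rewrite extend_rotation_loop; last by lra.
    by rewrite mul1r.
  rewrite extend_rotation_loop; last by lra.
  have -> : a * (k%:R * 2 * t + (1 - k%:R)) = k%:R * a * (2 * t + (- 1)) + a by ring.
  by rewrite rotateD; apply: cover_rotate.
- by move=> s; rewrite extend_path_val.
- by move=> t t01; rewrite v0 !mulr0 addr0 extend_path_le0.
- by move=> t t01; rewrite v1 !mulr1 subrK extend_path_ge1.
Qed.

End RotationPower.

(** A full turn commutes with the image of a path of configurations: turning
    all the configurations of the path sweeps out a square. *)
Lemma full_turn_commute (e e' : E) (f : {path I from e to e'})
    (ee' : p e' = p e) (turn : loop R (p e)) :
  (forall t, turn t = p (rotate (pi / r%:R * unit_interval_val t) e)) ->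
  commute (loop_class turn) (loop_class (cover_path f erefl ee' : loop R (p e))).
Proof.
move=> turnE; rewrite /commute [LHS]pi1_mulE [RHS]pi1_mulE.
apply/loop_classP/path_homotopic_sym.
pose K (st : I * I) := p (rotate (pi / r%:R * unit_interval_val st.2 + 0) (f st.1)).
apply: (@square_commute _ _ _ _ _ K).
- apply: comp_continuous (@cover_continuous R r n r_gt0).
  apply: rotate_continuous.
    exact: affine_continuous (@unit_interval_snd_continuous R).
  exact: comp_continuous (@fst_continuous _ _) (@cts_fun _ _ f).
- move=> s; rewrite /K /= unit_interval_val0 unit_interval_val1.
  by rewrite mulr0 mulr1 !addr0 rotate0 cover_full_turn.
- move=> t; rewrite /K /= addr0 turnE path_zero path_one.
  by split=> //; exact: cover_rotate.
Qed.

End RotationLoops.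

(** * Two loops that do not commute *)

Section NonCommuting.
Variables (R : realType) (r n : nat).
Local Notation C := (complexes R).
Local Notation I := (unit_interval R).
Local Notation m := (2 * r)%N.
Local Notation E := (configuration R n m).
Hypotheses (r_gt0 : (0 < r)%N) (n_gt1 : (1 < n)%N).
Local Notation p := (@cover R r n r_gt0).

Let n_gt0 : (0 < n)%N := ltnW n_gt1.
Let i0 : 'I_n := Ordinal n_gt0.
Let i1 : 'I_n := Ordinal n_gt1.

(** The [2r]-th powers of the numbers [expi (k * step_angle)] run through the
    [n]-th roots of unity. *)
Definition step_angle : R := pi / r%:R / n%:R.

Lemma step_angleX (k : nat) :
  expi (k%:R * step_angle) ^+ m = expi (k%:R / n%:R * (pi *+ 2)) :> C.
Proof.
rewrite expiX; congr expi; rewrite /step_angle -[LHS]mulr_natr -[pi *+ 2]mulr_natr natrM.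
have nn : n%:R != 0 :> R by rewrite pnatr_eq0 -lt0n.
have rr : r%:R != 0 :> R by rewrite pnatr_eq0 -lt0n.
by field; rewrite nn rr.
Qed.

Lemma regular_polygon_subproof :
  @monomial_complement R m n (\col_i expi ((i : nat)%:R * step_angle)).
Proof.
have nn : (0 : R) < n%:R by rewrite ltr0n.
have pi0 := pi_gt0 R.
apply/monomial_complementP; split=> [i|i j]; first by rewrite mxE expi_neq0.
suff lt_inj (k l : nat) : (k < l)%N -> (l < n)%N ->
    expi (k%:R * step_angle) ^+ m <> expi (l%:R * step_angle) ^+ m :> C.
  rewrite !mxE => ij; case: (ltngtP i j) => [/lt_inj|/lt_inj|/val_inj //].
    by move=> /(_ (ltn_ord _)) /(_ ij).
  by move=> /(_ (ltn_ord _)) /(_ (esym ij)).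
move=> kl ln; rewrite !step_angleX => kl_eq.
have lE : l%:R / n%:R * (pi *+ 2) =
    (l - k)%N%:R / n%:R * (pi *+ 2) + k%:R / n%:R * (pi *+ 2) :> R.
  by rewrite -!mulrDl natrB ?subrK // ltnW.
have lk1 : expi ((l - k)%N%:R / n%:R * (pi *+ 2)) = 1 :> C.
  apply: (mulIf (expi_neq0 (k%:R / n%:R * (pi *+ 2) : R))).
  by rewrite -expiD -lE -kl_eq mul1r.
have pp : (0 : R) < pi *+ 2 by rewrite mulrn_wgt0.
have : expi ((l - k)%N%:R / n%:R * (pi *+ 2)) != 1 :> C.
  apply: expi_neq1; apply/andP; split.
    by rewrite mulr_gt0 // divr_gt0 // ltr0n subn_gt0.
  rewrite gtr_pMl // ltr_pdivrMr // mul1r ltr_nat.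
  by rewrite (leq_ltn_trans (leq_subr _ _)).
by rewrite lk1 eqxx.
Qed.

Definition regular_polygon : E := config regular_polygon_subproof.

Lemma coord_polygon i : coord regular_polygon i = expi ((i : nat)%:R * step_angle).
Proof. by rewrite /coord /= mxE. Qed.

Definition shift : {perm 'I_n} := perm (@ordS_inj n).

Lemma rotate_polygonX i :
  coord (rotate r_gt0 step_angle regular_polygon) i ^+ m =
  coord regular_polygon (shift i) ^+ m.
Proof.
rewrite coord_rotate !coord_polygon permE -expiD /=.
have -> : step_angle + (i : nat)%:R * step_angle = (i.+1)%:R * step_angle.
  by rewrite -[X in X + _]mul1r -mulrDl -mulrS.
have [iS|iS] := ltnP i.+1 n; first by rewrite modn_small.
have -> : i.+1 = n by apply/eqP; rewrite eqn_leq iS ltn_ord.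
rewrite modnn !step_angleX divff ?mul1r ?mul0r ?expi0 ?expi2pi //.
by rewrite pnatr_eq0 -lt0n.
Qed.

Lemma flip_subproof :
  @monomial_complement R m n
    (\col_i ((if i == i0 then -1 else 1) * coord regular_polygon i)).
Proof.
apply: (@scale_subproof _ _ _ r_gt0 _ regular_polygon 1) => [|i].
  exact: oner_neq0.
by case: ifP => _; rewrite ?expr1n // exprM sqrrN !expr1n.
Qed.

Definition flipped_polygon : E := config flip_subproof.

Lemma coord_flipped i : coord flipped_polygon i =
  (if i == i0 then -1 else 1) * coord regular_polygon i.
Proof. by rewrite {1}/coord mxE. Qed.

Lemma cover_flipped : p flipped_polygon = p regular_polygon.
Proof.
apply/esym/coverP; exists 1%g => i; rewrite perm1 coord_flipped exprMn.
by case: ifP => _; rewrite ?expr1n ?mul1r // exprM sqrrN !expr1n mul1r.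
Qed.

Lemma cover_step : p (rotate r_gt0 step_angle regular_polygon) = p regular_polygon.
Proof. apply/esym/coverP; exists shift => i; exact: rotate_polygonX. Qed.

Definition step_loop : loop R (p regular_polygon) := rotation_loop cover_step 1.

Lemma step_loopE t :
  step_loop t = p (rotate r_gt0 (step_angle * unit_interval_val t) regular_polygon).
Proof. by rewrite rotation_loopE mul1r. Qed.

Variable flip_path : {path I from regular_polygon to flipped_polygon}.

Definition flip_loop : loop R (p regular_polygon) :=
  cover_path flip_path erefl cover_flipped.

Lemma step_exp_commute :
  commute (loop_class step_loop ^+ n)%g (loop_class flip_loop).
Proof.
rewrite rotation_loop_exp; apply: full_turn_commute => t.
rewrite rotation_loopE; congr (p (rotate _ _ _)); congr (_ * _).
by rewrite /step_angle mulrC divfK // pnatr_eq0 -lt0n.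
Qed.

(** The lifts of the two products end at configurations with opposite
    coordinates [0], since flipping the sign of coordinate [0] does not commute
    with the cyclic shift. *)
Lemma step_flip_not_commute :
  ~ commute (loop_class step_loop) (loop_class flip_loop).
Proof.
rewrite /commute [X in X = _]pi1_mulE [X in _ = X]pi1_mulE => /loop_classP sf.
(* the deck map that takes the polygon to its rotation takes the flip path to
   its lift from the end of the step *)
have [d [cd pd dE]] := deck_transformation r_gt0 rotate_polygonX.
have d0 : d (flip_path zero) = rotate r_gt0 step_angle regular_polygon.
  by apply: configuration_eq => i; rewrite path_zero dE mulfVK ?coord_neq0.
have d1 : d (flip_path one) = d flipped_polygon by rewrite path_one.
have cdf : continuous (fun t : I => d (flip_path t)).
  exact: comp_continuous (@cts_fun _ _ flip_path) cd.
pose moved : {path I from rotate r_gt0 step_angle regular_polygon to d flipped_polygon} :=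
  mk_path cdf d0 d1.
have lift1 t : p (concat_path (rotation_path r_gt0 step_angle regular_polygon) moved t) =
    concat_path step_loop flip_loop t.
  apply: concat_path_lift => {}t; first by rewrite rotation_pathE step_loopE.
  by rewrite -[LHS]/(p (d (flip_path t))) pd.
have lift2 t : p (concat_path flip_path (rotation_path r_gt0 step_angle flipped_polygon) t) =
    concat_path flip_loop step_loop t.
  apply: concat_path_lift => {}t //.
  by rewrite rotation_pathE step_loopE; apply: cover_rotate; exact: cover_flipped.
have := monodromy (@configuration_hausdorff R n m) (@cover_covering R r n r_gt0)
  sf lift1 lift2.
move=> /(congr1 (fun e : E => coord e i0)).
have s0 : shift i0 = i1 by apply: val_inj; rewrite permE /= modn_small.
rewrite dE s0 !coord_rotate !coord_flipped !coord_polygon /=.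
rewrite mul0r expi0 !mulr1 !mul1r divff ?expi_neq0 // mul1r.
move=> /eqP; rewrite mulrN1 -addr_eq0 -mulr2n mulrn_eq0 /=.
by apply/negP; exact: expi_neq0.
Qed.

End NonCommuting.

(** * Failure of residual freeness *)

Theorem mainTheorem8 (R : realType) (r n : nat)
    (hr : (1 <= r)%N) (hn : (2 <= n)%N) (b : monomial_orbit_space R r n) :
  ~ residually_free (monomial_braid_group b).
Proof.
have [e eb] := cover_surj hr b.
have [flip] := configuration_path_connected
  (regular_polygon R hr hn) (flipped_polygon R hr hn).
have [c] := configuration_path_connected e (regular_polygon R hr hn).
pose base := cover_path c eb (erefl (cover hr (regular_polygon R hr hn))).
have baseM := change_baseM base.
pose f : {multiplicative fundamental_group R (cover hr (regular_polygon R hr hn)) ->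
    monomial_braid_group b} :=
  HB.pack (change_base base) (isMultiplicative.Build _ _ _ baseM).
move=> /(residually_free_sub (f := f) (@change_base_inj _ _ _ _ base)) resG.
apply: (@step_flip_not_commute R r n hr hn flip).
apply: (residually_free_commute_root (n := n.-1) resG).
rewrite prednK ?(ltnW hn) //; exact: step_exp_commute.
Qed.
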